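(* Let $\Bbbk$ be an algebraically closed field, let $X\subseteq \mathrm{Gr}(r,n)$ be a toric Richardson variety over $\Bbbk$, and let $T\subset GL_n$ be the diagonal torus. Then there is a one-parameter subgroup $v:\mathbb G_m\to T$ such that the $\mathbb G_m$-action on $X$ induced by $v$ has finitely many fixed points and the Białynicki-Birula cells $X_p^{v}=\{x\in X\mid \lim_{t\to 0}v(t)\cdot x=p\}$ (for $p\in X^{\mathbb G_m}$) form a $T$-invariant affine paving of $X$.
   Context: $\mathrm{Gr}(r,n)$ is the Grassmannian of $r$-dimensional subspaces $L\subseteq\Bbbk^n$, written as row spans of $r\times n$ matrices $A_L$; $g\in GL_n$ acts by $L\mapsto$ row span of $A_Lg^{-1}$. Let $B^+$ (resp. $B^-$) be the upper (resp. lower) triangular subgroup. For a partition $\lambda$ fitting in the rectangle with $r$ rows and $n-r$ columns (English convention), its lower boundary path goes from the southwest to the northeast corner of the rectangle by unit north/east steps; $I(\lambda)\subseteq[n]$ is the set of positions of its north steps, and $\Bbbk^{I}$ is the span of $e_i$, $i\in I$. Put $\Omega_\lambda=\overline{B^-\Bbbk^{I(\lambda)}}$, $\Omega^\lambda=\overline{B^+\Bbbk^{I(\lambda)}}$. For $\mu\subseteq\lambda$ the Richardson variety is $\Omega_\lambda^\mu=\Omega_\lambda\cap\Omega^\mu$, of dimension $|\lambda|-|\mu|$. It is a toric Richardson variety if it admits the structure of a toric variety; equivalently, it has a dense $T$-orbit; equivalently, the skew diagram $\lambda/\mu$ contains no $2\times2$ square. An affine paving of a variety $X$ is a decomposition into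 disjoint subsets $X=X_0\sqcup\cdots\sqcup X_k$ such that each partial union $X_0\sqcup\cdots\sqcup X_i$ is closed in $X$ and each $X_i$ is isomorphic to an affine space $\mathbb A^{n_i}$. *)

(* Defs.v *)
From HB Require Import structures.
From mathcomp Require Import all_boot all_order all_algebra.
From mathcomp Require Import mpoly.
From mathcomp Require Import mathcomp_extra boolp classical_sets cardinality.

Set Implicit Arguments.
Unset Strict Implicit.
Unset Printing Implicit Defensive.

Import GRing.Theory.
Local Open Scope ring_scope.
Local Open Scope classical_set_scope.

(* A point of a coordinatized space may have several coordinate vectors: the
   carrier is to be thought of as a quotient of a subset of k^dim (every point
   has a coordinate vector, and a vector represents at most one point).  The
   Zariski topology and the regular functions below are the quotient ones. *)
Record coord_space (k : closedFieldType) := CoordSpace {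
  point :> Type;
  coord_dim : nat;
  coords : point -> 'rV[k]_coord_dim -> Prop
}.
Arguments CoordSpace {k} point coord_dim coords.
Arguments coords {k} c.

Section Varieties.
Variable k : closedFieldType.

Definition zariski_closed (M : coord_space k) (Z : set M) : Prop :=
  exists S : set {mpoly k[coord_dim M]},
    Z = [set x | forall P, S P -> forall a, coords M x a -> P.@[a 0] = 0].

Definition zariski_closure (M : coord_space k) (X : set M) : set M :=
  \bigcap_(Z in [set Z | zariski_closed Z /\ X `<=` Z]) Z.

Definition closed_in (M : coord_space k) (X Z : set M) : Prop :=
  exists2 C : set M, zariski_closed C & Z = X `&` C.

(* f coincides with the fraction P / Q on the points of X near x; in
   particular P / Q takes there the same value on all the coordinate vectors
   of a point at which Q does not vanish. *)
Definition regular_at (M : coord_space k) (X : set M) (f : M -> k) (x : M) :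
    Prop :=
  exists P Q : {mpoly k[coord_dim M]},
    (exists2 a, coords M x a & Q.@[a 0] != 0) /\
    (forall y b, X y -> coords M y b -> Q.@[b 0] != 0 ->
       f y = P.@[b 0] / Q.@[b 0]).

(* The subsets X and Y are meant to be locally closed; they carry the reduced
   induced structure, and the values of f outside X are irrelevant. *)
Definition morphism (M N : coord_space k) (X : set M) (Y : set N)
    (f : M -> N) : Prop :=
  [/\ f @` X `<=` Y,
      forall Z, closed_in Y Z -> closed_in X (X `&` f @^-1` Z) &
      forall x g, X x -> regular_at Y g (f x) -> regular_at X (g \o f) x].

Definition isomorphic (M N : coord_space k) (X : set M) (Y : set N) : Prop :=
  exists (f : M -> N) (g : N -> M),
    [/\ morphism X Y f, morphism Y X g,
        forall x, X x -> g (f x) = x & forall y, Y y -> f (g y) = y].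

Definition affine_line : coord_space k :=
  CoordSpace k 1 (fun t a => a = const_mx t).

Definition affine_space (m : nat) : coord_space k :=
  CoordSpace 'rV[k]_m m (fun x a => a = x).

Definition matrix_space (n : nat) : coord_space k :=
  CoordSpace 'M[k]_n (n * n) (fun A a => a = mxvec A).

Definition Gm : set affine_line := [set t : k | t != 0].

Definition affine_paving (M : coord_space k) (X : set M) (j : nat)
    (C : 'I_j.+1 -> set M) : Prop :=
  [/\ X = \bigcup_i C i,
      forall i i', i != i' -> C i `&` C i' = set0,
      forall i : 'I_j.+1,
        closed_in X (\bigcup_(i' in [set i' : 'I_j.+1 | (i' <= i)%N]) C i') &
      forall i, exists m : nat, isomorphic (C i) [set: affine_space m]].

(* lim_(t -> 0) phi t = p in X: the map phi on Gm extends to the affine line *)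
Definition limit0 (M : coord_space k) (X : set M) (phi : k -> M) (p : M) :
    Prop :=
  exists psi : affine_line -> M,
    [/\ morphism [set: affine_line] X psi,
        forall t : k, t != 0 -> psi t = phi t & psi 0 = p].

End Varieties.

Arguments Gm {k}.

Section Grassmannian.
Variables (k : closedFieldType) (r n : nat).

Definition row_span (A : 'M[k]_(r, n)) : {vspace 'rV[k]_n} :=
  <<[seq row i A | i : 'I_r]>>%VS.

Definition subspaces : Type := {L : {vspace 'rV[k]_n} | \dim L == r}.

Definition Gr : coord_space k :=
  CoordSpace subspaces (r * n) (fun L a => row_span (vec_mx a) = val L).

Definition vspace_act (g : 'M[k]_n) (L : {vspace 'rV[k]_n}) :
    {vspace 'rV[k]_n} :=
  (linfun (mulmxr (invmx g) : 'rV[k]_n -> 'rV[k]_n) @: L)%VS.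

(* Only meaningful for invertible g, see gr_actE. *)
Definition gr_act (g : 'M[k]_n) (L : Gr) : Gr :=
  insubd (L : subspaces) (vspace_act g (val L)).

Lemma dim_vspace_act g L : g \in unitmx -> \dim (vspace_act g L) = \dim L.
Proof.
move=> gU; apply: limg_dim_eq; apply/eqP.
suff -> : lker (linfun (mulmxr (invmx g) : 'rV[k]_n -> 'rV[k]_n)) = 0%VS.
  by rewrite capv0.
apply/eqP/lker0P => x y; rewrite !lfunE /= => /(congr1 (mulmx^~ g)).
by rewrite !mulmxKV.
Qed.

Lemma gr_actE g (L : Gr) :
  g \in unitmx -> val (gr_act g L) = vspace_act g (val L).
Proof.
by move=> gU; rewrite val_insubd dim_vspace_act // (valP (L : subspaces)).
Qed.

Lemma vspace_act_row_span g (A : 'M[k]_(r, n)) :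
  vspace_act g (row_span A) = row_span (A *m invmx g).
Proof.
rewrite /vspace_act /row_span limg_span -map_comp; congr <<_>>%VS.
by apply: eq_map => i; rewrite /= lfunE /= row_mul.
Qed.

Definition B_plus : set 'M[k]_n :=
  [set g | (g \in unitmx) && is_trig_mx g^T].
Definition B_minus : set 'M[k]_n :=
  [set g | (g \in unitmx) && is_trig_mx g].
Definition torus : set (matrix_space k n) :=
  [set g : 'M[k]_n | (g \in unitmx) && is_diag_mx g].

(* Partitions are listed with their trailing zeros: one part for each row. *)
Definition partition_in_box (la : seq nat) : bool :=
  [&& size la == r, sorted geq la & all (leq^~ (n - r)%N) la].

Definition included (mu la : seq nat) : bool :=
  all2 leq mu la.

(* The lower boundary path from southwest to northeast, north steps being
   true and east steps false: steps s x is the part of it which starts from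
   column x, s listing the remaining rows from bottom to top. *)
Fixpoint steps (s : seq nat) (x : nat) : seq bool :=
  if s is a :: s' then nseq (a - x) false ++ true :: steps s' a
  else nseq (n - r - x) false.

Definition lower_path (la : seq nat) : seq bool := steps (rev la) 0.

Definition north_steps (la : seq nat) : pred 'I_n :=
  fun i => nth false (lower_path la) i.

Definition coord_subspace (I : pred 'I_n) : {vspace 'rV[k]_n} :=
  (\sum_(i | I i) <[delta_mx (0 : 'I_1)%R i]>)%VS.

Definition orbit_of (B : set 'M[k]_n) (L0 : {vspace 'rV[k]_n}) : set Gr :=
  [set L : Gr | exists2 b, B b & val L = vspace_act b L0].

Definition Omega_lower (la : seq nat) : set Gr :=
  zariski_closure (orbit_of B_minus (coord_subspace (north_steps la))).

Definition Omega_upper (mu : seq nat) : set Gr :=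
  zariski_closure (orbit_of B_plus (coord_subspace (north_steps mu))).

Definition richardson (la mu : seq nat) : set Gr :=
  Omega_lower la `&` Omega_upper mu.

Definition has_dense_torus_orbit (X : set Gr) : Prop :=
  exists2 x, X x & X `<=` zariski_closure (orbit_of torus (val x)).

(* Richardson varieties being normal and irreducible, a dense torus orbit is
   what makes them toric varieties (for a quotient of the torus). *)
Definition toric_richardson (X : set Gr) : Prop :=
  (exists la mu, [/\ partition_in_box la, partition_in_box mu,
                     included mu la & X = richardson la mu]) /\
  has_dense_torus_orbit X.

Definition one_parameter_subgroup (v : k -> 'M[k]_n) : Prop :=
  morphism (M := affine_line k) (N := matrix_space k n) Gm torus v /\
  (forall s t : k, s != 0 -> t != 0 -> v (s * t) = v s *m v t).

Definition Gm_fixed (v : k -> 'M[k]_n) (X : set Gr) : set Gr :=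
  [set x | X x /\ forall t : k, t != 0 -> gr_act (v t) x = x].

Definition BB_cell (v : k -> 'M[k]_n) (X : set Gr) (p : Gr) : set Gr :=
  [set x | X x /\ limit0 X (fun t => gr_act (v t) x) p].

Definition torus_invariant (C : set Gr) : Prop :=
  forall t x, torus t -> C x -> C (gr_act t x).

End Grassmannian.

(* Main.v *)
Require Import Defs.
From mathcomp Require Import all_boot all_order perm all_algebra.
From mathcomp Require Import zify ring.
From mathcomp Require Import mpoly.
From mathcomp Require Import boolp classical_sets cardinality.

(** Let b and a be the north steps of the paths of la and mu. In terms of the
    heights [cnt f x], the number of north steps of f before abscissa x, the
    coordinate subspaces of the Richardson variety R are the k^f such that f is
    between the two paths, and a point belongs to R if and only if its nonzero
    Pluecker coordinates are of this kind ([richardson_minor],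
    [richardson_of_minors]). The converse part rests on a degeneration: a matrix
    with the staircase shape of a Schubert cell is a limit of matrices of the
    cell along a line ([schubert_staircase]).

    A dense torus orbit forces the heights of the two paths to differ by at most
    one everywhere. Otherwise the skew shape contains a 2 x 2 square, R contains
    a copy of Gr(2, 4), and a relation between two monomials of degree two in
    the Pluecker coordinates, which would propagate from the orbit to R, fails
    on this copy ([dense_orbit_thin]).

    R may be singular, and a general one-parameter subgroup does not give affine
    cells. A good one has distinct exponents, those of the columns in b being
    smaller than those of all later columns, the others larger than those of all
    later columns ([weight]). Taking the columns of a nonzero minor of greatest
    weight as pivots, every point of Gr has a reduced matrix whose other nonzero
    entries are in columns lighter than the pivot of their row ([echelon_form]);
    the torus contracts them, and the limit is the coordinate subspace of the
    pivots. For a point of R the nonzero entries (i, j) are moreover such that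
    the exchange of the pivot f i for j leads to another sequence between the two
    paths, because the entry is a minor up to sign.

    Conversely, and this is where the choice of the weights matters, all matrices
    with pivots f and such entries represent points of R, without any relation
    between the entries ([cell_richardson]). Indeed a nonzero term of a minor
    performs several allowed exchanges at once, and in a strip of width one at
    most one of them can lower, and at most one can raise, the height at a given
    abscissa ([transversal_lower], [transversal_upper]). Hence the cells are
    affine spaces ([cell_affine]). They are the Bialynicki-Birula cells since
    limits are unique ([limit_cell]), and they are torus invariant by
    construction. The pivots of a point are characterized by the nonzero minor
    of greatest weight, so that unions of cells in increasing order of weight
    are cut out of R by the vanishing of minors ([cells_paving]). *)

Set Implicit Arguments.
Unset Strict Implicit.
Unset Printing Implicit Defensive.

Import GRing.Theory.
Local Open Scope ring_scope.
Local Open Scope classical_set_scope.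

(** * Counting functions of lattice paths *)

Section Counting.
Variables r n : nat.
Implicit Types (f g : 'I_r -> 'I_n) (i l : 'I_r) (j : 'I_n).
Local Open Scope nat_scope.

(** The height of the lattice path with north steps f at abscissa x; unlike the
    sequence of its north steps, it is meaningful for unsorted f. *)
Definition cnt f (x : nat) : nat := \sum_(i < r) (f i < x).

Definition increasing f : bool := [forall i : 'I_r, forall l : 'I_r, (i < l) ==> (f i < f l)].

Definition upd f i j : 'I_r -> 'I_n := fun l => if l == i then j else f l.

Lemma increasingP f :
  reflect (forall i l, i < l -> f i < f l) (increasing f).
Proof.
apply: (iffP forallP) => [H i l | H i]; first by have /forallP/(_ l)/implyP := H i.
by apply/forallP => l; apply/implyP/H.
Qed.

Lemma increasing_inj f : increasing f -> injective f.
Proof.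
move/increasingP => H i l E; apply/val_inj.
by case: (ltngtP i l) => // /H; rewrite E ltnn.
Qed.

Lemma sum_ltn_ord m : m <= r -> \sum_(l < r) (l < m) = m.
Proof.
move=> le; transitivity (\sum_(l < r | l < m) 1).
  by rewrite [RHS]big_mkcond; apply: eq_bigr => l _; case: ltnP.
by rewrite (big_ord_narrow le) sum1_card card_ord.
Qed.

(** The entries below x form an initial segment, so that the counting function
    determines an increasing sequence. *)
Lemma lt_increasing_cnt f x i : increasing f -> (f i < x) = (i < cnt f x).
Proof.
move/increasingP => H; apply/idP/idP => [fx | ].
  rewrite -{1}(@sum_ltn_ord i.+1) //; apply: leq_sum => l _.
  rewrite ltnS; case: (ltngtP l i) => // [li | /val_inj ->]; last by rewrite fx.
  by rewrite (ltn_trans (H _ _ li) fx).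
apply: contraTT; rewrite -!leqNgt => fx.
rewrite -[leqRHS](sum_ltn_ord (ltnW (ltn_ord i))); apply: leq_sum => l _.
case: (ltnP l i) => [_ | il]; first exact: leq_b1.
rewrite ltnNge (leq_trans fx) //; move: il; rewrite leq_eqVlt.
by case/orP => [/eqP/val_inj -> // | /H/ltnW].
Qed.

Lemma cnt_le f x : cnt f x <= r.
Proof.
rewrite -[leqRHS](card_ord r) -sum1_card; apply: leq_sum => i _; exact: leq_b1.
Qed.

Lemma eq_cnt f g x : f =1 g -> cnt f x = cnt g x.
Proof. by move=> E; apply: eq_bigr => i _; rewrite E. Qed.

Lemma cnt_perm f (s : 'S_r) x : cnt (f \o s) x = cnt f x.
Proof. by rewrite [RHS](reindex_inj (@perm_inj _ s)). Qed.

Lemma cnt_upd f i j x : cnt (upd f i j) x + (f i < x) = cnt f x + (j < x).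
Proof.
rewrite /cnt (bigD1 i) //= [in RHS](bigD1 i) //= /upd eqxx.
rewrite [X in _ + X + _](eq_bigr (fun l => (f l < x) : nat)); first by lia.
by move=> l /negPf ->.
Qed.

Lemma cntS_notin f j : (forall i, f i != j) -> cnt f j.+1 = cnt f j.
Proof.
move=> H; apply: eq_bigr => i _; rewrite ltnS leq_eqVlt.
by rewrite (negPf (H i) : (f i == j :> nat) = false).
Qed.

Lemma cntS_in f i : (cnt f (f i)).+1 <= cnt f (f i).+1.
Proof.
rewrite /cnt (bigD1 i) //= [leqRHS](bigD1 i) //= ltnn ltnSn add0n add1n ltnS.
by apply: leq_sum => l _; rewrite ltnS; case: ltngtP.
Qed.

Lemma sort_perm f : injective f -> exists s : 'S_r, increasing (f \o s).
Proof.
move=> fI; pose t := [tuple f i | i < r].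
pose u := sort (fun x y : 'I_n => x <= y) t.
have /tuple_permP [s Es] : perm_eq u t by rewrite perm_sort.
have su : sorted (fun x y : 'I_n => x < y) u.
  have : sorted (fun x y : 'I_n => x <= y) u by apply: sort_sorted => x y; apply: leq_total.
  have : uniq u by rewrite sort_uniq map_inj_uniq ?enum_uniq.
  clear; elim: u => //= x u IH /andP[xu uu]; case: u xu uu IH => //= y u xu uu IH.
  case/andP=> xy yu; rewrite IH // ltn_neqAle xy !andbT.
  by apply: contraNneq xu => /val_inj ->; rewrite inE eqxx.
exists s; apply/increasingP => i l il /=.
have nthE m : f (s m) = nth (f i) u m.
  by rewrite Es (nth_map m) ?size_enum_ord ?nth_ord_enum ?tnth_mktuple // size_tuple.
have sz : size u = r by rewrite Es size_tuple.
rewrite !nthE; apply: (sorted_ltn_nth (leT := fun x y : 'I_n => x < y)) => //.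
- by move=> y x z; apply: ltn_trans.
- by rewrite inE sz.
- by rewrite inE sz.
Qed.

(** Two sequences with the same values have the same counting function. *)
Lemma increasing_eq f g (s : 'S_r) :
  increasing f -> increasing g -> (forall i, g (s i) = f i) -> f =1 g.
Proof.
move=> fi gi E i; have c x : cnt f x = cnt g x.
  by rewrite -(cnt_perm g s); apply: eq_cnt => l /=.
have lt x : (f i < x) = (g i < x) by rewrite !lt_increasing_cnt // c.
by apply/val_inj/eqP; rewrite eqn_leq /= -ltnS lt ltnSn -ltnS -lt ltnSn.
Qed.

(** ** Transversals of a cell *)

(** The exponents of the one-parameter subgroup; only their order matters. The
    north steps of the lower path b come before all later positions, the other
    positions come after all later ones. This is the order given by a linear
    combination of the heights of the path in which the earlier heights
    dominate the later ones, the sign of each being given by the step of b. When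
    the heights are added one at a time from left to right, at most one edge
    along which the weight decreases moves the last height, whatever the fixed
    point it starts from; this keeps the cells smooth. *)
Definition weight (b : 'I_r -> 'I_n) j : nat :=
  if j \in codom b then j : nat else n + n - j.

Lemma weight_inj b : injective (weight b).
Proof.
move=> j j'; rewrite /weight; have := ltn_ord j; have := ltn_ord j'.
by case: ifP; case: ifP => _ _ ? ? E; apply/val_inj => /=; lia.
Qed.

Lemma weight_north b j j' : j \in codom b -> j < j' -> weight b j < weight b j'.
Proof. by have := ltn_ord j'; rewrite /weight => ? ->; case: ifP => _; lia. Qed.

Lemma weight_east b j j' : j \notin codom b -> j < j' -> weight b j' < weight b j.
Proof.
by have := ltn_ord j'; rewrite /weight => ? /negPf ->; case: ifP => _; lia.
Qed.

(** The exact condition, for increasing f, for the coordinate subspace of f to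
    lie in the Richardson variety of a and b. *)
Definition between (a b f : 'I_r -> 'I_n) : bool :=
  [forall x : 'I_n.+1, cnt b x <= cnt f x <= cnt a x].

Lemma betweenP a b f :
  reflect (forall x, x <= n -> cnt b x <= cnt f x <= cnt a x) (between a b f).
Proof.
apply: (iffP forallP) => [H x xn | H x]; last by apply: H; rewrite -ltnS.
by have := H (inord x); rewrite inordK.
Qed.

Lemma eq_between a b f g : f =1 g -> between a b f = between a b g.
Proof. by move=> E; apply: eq_forallb => x; rewrite (eq_cnt _ E). Qed.

Lemma between_perm a b f (s : 'S_r) : between a b (f \o s) = between a b f.
Proof. by apply: eq_forallb => x; rewrite cnt_perm. Qed.

Lemma card_le1_of_lt (T : finType) (P : pred T) (h : T -> nat) :
  {in P &, injective h} ->
  (forall u v : T, P u -> P v -> h u < h v -> False) -> \sum_u P u <= 1.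
Proof.
move=> hI H; rewrite (eq_bigr (fun u => if P u then 1 else 0)); last first.
  by move=> u _; case: (P u).
rewrite -big_mkcond sum1_card; apply/card_le1_eqP => u v Pu Pv; apply/hI => //.
by case: (ltngtP (h u) (h v)) => // E; [case: (H _ _ Pu Pv) | case: (H _ _ Pv Pu)].
Qed.

(** In this section f is the pivot sequence of a cell, and a matrix of the cell
    has nonzero entries at the positions (i, G i). Every single exchange of
    f i for G i stays between the paths; the point is that all the exchanges
    made at once do so too, because at each abscissa at most one of them counts
    in the dangerous direction. *)
Section Transversal.
Variables a b f G : 'I_r -> 'I_n.
Hypotheses (fI : injective f) (GI : injective G).
Hypothesis ab : forall x, x <= n -> cnt a x <= (cnt b x).+1.
Hypothesis okf : between a b f.
Hypothesis Gw : forall i, weight b (G i) <= weight b (f i).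
Hypothesis Gok : forall i, between a b (upd f i (G i)).
Hypothesis Gf : forall i l, G i = f l -> i = l.

(** Only exchanges over x to the right can bring the path below b. Suppose that
    two of them start at f i < f l. The first one requires that f be strictly
    above b all along its way, in particular on both sides of f l; since the
    strip has width one and f makes a north step at f l, so does b. But then
    f l is lighter than all later positions, in particular than G l. *)
Lemma transversal_lower x : x <= n -> cnt b x <= cnt G x.
Proof.
move=> xn; pose bad i := (f i < x) && (x <= G i).
have le : cnt f x <= cnt G x + \sum_i bad i.
  rewrite -big_split /=; apply: leq_sum => i _; rewrite /bad; lia.
have drop i y : f i < y -> y <= G i -> y <= n -> cnt b y < cnt f y.
  move=> fy yG yn; have /betweenP/(_ y yn)/andP[+ _] := Gok i.
  by have := cnt_upd f i (G i) y; rewrite fy ltnNge yG /=; lia.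
have /betweenP/(_ x xn)/andP[fx _] := okf.
case: (pickP bad) => [i /andP[i1 i2] | none]; last first.
  by rewrite (leq_trans fx) // (leq_trans le) // big1 ?addn0 // => i _; rewrite none.
suff : \sum_i bad i <= 1 by have := drop i x i1 i2 xn; lia.
apply: (@card_le1_of_lt _ _ (fun i => f i : nat)) => [i' l _ _ /val_inj/fI //|].
move=> {i1 i2}i l /andP[i1 i2] /andP[l1 l2] il.
have d1 := drop i (f l) il ltac:(lia) ltac:(lia).
have /andP[_ d2] := betweenP _ _ _ okf (f l).+1 ltac:(lia).
have d3 := cntS_in f l; have d4 := ab (leq_trans l1 xn).
have lb : f l \in codom b.
  apply: contraT => /negP nb; suff E : cnt b (f l).+1 = cnt b (f l) by lia.
  by apply: cntS_notin => m; apply: contra_notN nb => /eqP <-; apply: codom_f.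
by have := weight_north lb (leq_trans l1 l2); rewrite ltnNge Gw.
Qed.

(** Dually, only exchanges over x to the left can bring the path above a; if two
    of them end at G i < G l, then f runs along b around G l, where it has no
    north step, so that G l is heavier than all later positions, in particular
    than f l. *)
Lemma transversal_upper x : x <= n -> cnt G x <= cnt a x.
Proof.
move=> xn; pose bad i := (G i < x) && (x <= f i).
have le : cnt G x <= cnt f x + \sum_i bad i.
  rewrite -big_split /=; apply: leq_sum => i _; rewrite /bad; lia.
have raise i y : G i < y -> y <= f i -> y <= n -> cnt f y < cnt a y.
  move=> fy yG yn; have /betweenP/(_ y yn)/andP[_] := Gok i.
  by have := cnt_upd f i (G i) y; rewrite fy ltnNge yG /=; lia.
have /betweenP/(_ x xn)/andP[_ fx] := okf.
case: (pickP bad) => [i /andP[i1 i2] | none]; last first.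
  by apply: leq_trans le _; rewrite big1 ?addn0 // => i _; rewrite none.
suff : \sum_i bad i <= 1 by have := raise i x i1 i2 xn; lia.
apply: (@card_le1_of_lt _ _ (fun i => G i : nat)) => [i' l _ _ /val_inj/GI //|].
move=> {i1 i2}i l /andP[i1 i2] /andP[l1 l2] il.
have d1 := raise i (G l) il ltac:(lia) ltac:(lia).
have d2 := raise i (G l).+1 ltac:(lia) ltac:(lia) ltac:(lia).
have d3 : cnt f (G l).+1 = cnt f (G l).
  apply: cntS_notin => m; apply/eqP => E.
  by move: l2; rewrite (Gf (esym E)) E leqNgt l1.
have /andP[d4 _] := betweenP _ _ _ okf (G l) ltac:(lia).
have d5 := ab (x := (G l).+1) ltac:(lia).
have d5' := ab (x := (G l)) ltac:(lia).
have d6 := betweenP _ _ _ okf (G l).+1 ltac:(lia).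
have lb : G l \notin codom b.
  by apply/negP => /codomP[m E]; have := cntS_in b m; rewrite -E; lia.
by have := weight_east lb (leq_trans l1 l2); rewrite ltnNge Gw.
Qed.

End Transversal.
End Counting.

(** * Echelon forms *)

Lemma eq_of_sum_leq (T : finType) (h k : T -> nat) :
  (forall x, h x <= k x)%N -> (\sum_x k x <= \sum_x h x)%N -> h =1 k.
Proof.
move=> hk le x; apply/eqP; rewrite eqn_leq hk /= leqNgt; apply/negP => lt.
move: le; rewrite leqNgt => /negP; apply.
rewrite (bigD1 x) //= [ltnRHS](bigD1 x) //= -addSn leq_add //.
by apply: leq_sum => y _; apply: hk.
Qed.

Section Matrices.
Variables (F : fieldType) (r n : nat).
Implicit Types (A : 'M[F]_(r, n)) (f g : 'I_r -> 'I_n) (u : 'I_n -> nat).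

Lemma unitmx_transversal m (M : 'M[F]_m) :
  M \in unitmx -> exists s : 'S_m, forall i, M i (s i) != 0.
Proof.
rewrite unitmxE unitfE => dM.
case: (pickP (fun s : 'S_m => \prod_i M i (s i) != 0)) => [s /prodf_neq0 H | H].
  by exists s => i; apply: H.
move: dM; rewrite /determinant big1 ?eqxx // => s _.
by have /negbFE/eqP -> := H s; rewrite mulr0.
Qed.

Lemma colsub_unit_inj A g : colsub g A \in unitmx -> injective g.
Proof.
move=> U i l E; apply/eqP; apply: contraTT U => il.
rewrite unitmxE -det_tr unitfE (determinant_alternate il) ?eqxx // => j.
by rewrite !mxE E.
Qed.

Lemma colsub_perm_unit A g (s : 'S_r) :
  (colsub (g \o s) A \in unitmx) = (colsub g A \in unitmx).
Proof.
have -> : colsub (g \o s) A = col_perm s (colsub g A) by apply/matrixP => i j; rewrite !mxE.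
by rewrite col_permE unitmx_mul unitmx_perm andbT.
Qed.

Lemma eq_colsub f g A : f =1 g -> colsub f A = colsub g A.
Proof. by move=> E; apply/matrixP => i j; rewrite !mxE E. Qed.

Lemma unit_colsub_free A g : colsub g A \in unitmx -> row_free A.
Proof.
move=> U; apply: inj_row_free => v v0.
by rewrite -(mulmxK U v) mulmx_colsub v0 -[LHS]/(_ *m _) [colsub g _]mxsub_const mul0mx.
Qed.

Lemma row_free_colsub A : row_free A -> exists g, colsub g A \in unitmx.
Proof.
rewrite -row_leq_rank -mxrank_tr => rA; have fA : row_full A^T.
  by rewrite /row_full eqn_leq rank_leq_col.
exists (fullrankfun fA); have := fullrowsub_unit fA.
by rewrite -unitmx_tr; congr (_ \in unitmx); apply/matrixP => i j; rewrite !mxE.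
Qed.

(** The matrix of the coordinate subspace spanned by the e_(f i). *)
Definition selector f : 'M[F]_(r, n) := \matrix_(i, j) (j == f i)%:R.

Lemma colsub_selector f : injective f -> colsub f (selector f) = 1%:M.
Proof. by move=> fI; apply/matrixP => i l; rewrite !mxE (inj_eq fI) eq_sym. Qed.

Definition echelon u f A : Prop :=
  colsub f A = 1%:M /\ forall i j, A i j != 0 -> (u j <= u (f i))%N.

Lemma colsub1E f A i l : colsub f A = 1%:M -> A i (f l) = (i == l)%:R.
Proof. by move/matrixP/(_ i l); rewrite !mxE. Qed.

(** The minor equals the entry (i, j), all other columns being unit vectors. *)
Lemma colsub_upd_unit f A i j :
  colsub f A = 1%:M -> A i j != 0 -> colsub (upd f i j) A \in unitmx.
Proof.
move=> f1 Aij; rewrite -row_free_unit; apply: inj_row_free => v v0.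
have vl l : v 0 l = 0.
  have vne m : m != i -> v 0 m = 0.
    move=> mi; have /rowP/(_ m) := v0; rewrite !mxE (bigD1 m) //= big1 => [|p pm].
      by rewrite !mxE /upd (negPf mi) (colsub1E _ _ f1) eqxx mulr1 addr0.
    by rewrite !mxE /upd (negPf mi) (colsub1E _ _ f1) (negPf pm) mulr0.
  have [-> | ] := eqVneq l i; last exact: vne.
  have /rowP/(_ i) := v0; rewrite !mxE (bigD1 i) //= big1 => [|p pm].
    by rewrite !mxE /upd eqxx addr0 => /eqP; rewrite mulf_eq0 (negPf Aij) orbF => /eqP.
  by rewrite vne // mul0r.
by apply/rowP => l; rewrite vl mxE.
Qed.

(** The pivots are the columns of a nonzero maximal minor of greatest weight:
    an entry heavier than the pivot of its row would give a heavier minor. *)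
Lemma echelon_form u A : row_free A ->
  exists (h : 'M[F]_r) f, [/\ h \in unitmx, increasing f & echelon u f (h *m A)].
Proof.
move=> /row_free_colsub [f0 f0U].
pose P (f : {ffun 'I_r -> 'I_n}) := colsub f A \in unitmx.
have P0 : P [ffun i => f0 i] by rewrite /P (@eq_colsub _ f0) // => i; rewrite ffunE.
case: (arg_maxnP (fun f : {ffun 'I_r -> 'I_n} => \sum_i u (f i)) P0) => f fU fmax.
have [s fs] := sort_perm (colsub_unit_inj fU).
have sU : colsub (f \o s) A \in unitmx by rewrite colsub_perm_unit.
have c1 : colsub (f \o s) (invmx (colsub (f \o s) A) *m A) = 1%:M.
  by rewrite -mulmx_colsub mulVmx.
exists (invmx (colsub (f \o s) A)), (f \o s); split; rewrite ?unitmx_inv //.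
split=> // i j nz; rewrite leqNgt; apply/negP => lt.
have U := colsub_upd_unit c1 nz.
have {}U : P [ffun l => upd (f \o s) i j l].
  rewrite /P (@eq_colsub _ (upd (f \o s) i j)); last by move=> l; rewrite ffunE.
  by move: U; rewrite -mulmx_colsub unitmx_mul unitmx_inv sU.
have /= := fmax _ U; rewrite leqNgt => /negP; apply.
rewrite (reindex_inj (@perm_inj _ s)) (bigD1 i) //= [ltnRHS](bigD1 i) //= ffunE /upd eqxx.
rewrite -addSn leq_add //; apply: leq_sum => l li.
by rewrite ffunE (negPf li).
Qed.

(** Each nonzero term in the expansion of the minor g moves the pivots to entries
    of their rows, hence to columns which are not heavier. *)
Lemma echelon_dominant u f A g : echelon u f A -> colsub g A \in unitmx ->
  (\sum_i u (g i) <= \sum_i u (f i))%N.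
Proof.
case=> _ H /unitmx_transversal [s sP].
rewrite (reindex_inj (@perm_inj _ s)); apply: leq_sum => i _.
by apply: H; have := sP i; rewrite !mxE.
Qed.

Lemma echelon_pivots u f A g : injective u -> increasing f -> increasing g ->
  echelon u f A -> colsub g A \in unitmx ->
  (\sum_i u (f i) <= \sum_i u (g i))%N -> f =1 g.
Proof.
move=> uI fi gi [_ H] /unitmx_transversal [s sP] le.
apply: (increasing_eq (s := s)) => // i; apply: uI; move: i.
apply: eq_of_sum_leq => [i |]; first by apply: H; have := sP i; rewrite !mxE.
by apply: leq_trans le _; rewrite (reindex_inj (@perm_inj _ s)).
Qed.

(** ** Triangular matrices for the order given by a weight *)

Definition triangular u (N : 'M[F]_n) : Prop :=
  forall i j, N i j != 0 -> (u j <= u i)%N.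

Lemma triangular_diag u N : injective u -> triangular u N -> N \in unitmx ->
  forall i, N i i != 0.
Proof.
move=> uI tN /unitmx_transversal [s sP] i.
have : u \o s =1 u.
  apply: eq_of_sum_leq => [l |]; first exact: tN.
  by rewrite [leqLHS](reindex_inj (@perm_inj _ s)).
by move/(_ i)/uI => {2}<-.
Qed.

Lemma triangular_unit u N : injective u -> triangular u N ->
  (forall i, N i i != 0) -> N \in unitmx.
Proof.
move=> uI tN dN; rewrite -row_free_unit; apply: inj_row_free => v v0.
apply/rowP => i0; rewrite mxE; apply/eqP/negPn/negP => vi0.
case: (arg_maxnP u (vi0 : (fun i => v 0 i != 0) i0)) => i vi imax.
have /rowP/(_ i) := v0; rewrite !mxE (bigD1 i) //= big1 => [|l li].
  by move/eqP; rewrite addr0 mulf_eq0 (negPf vi) (negPf (dN i)).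
have [-> | vl] := eqVneq (v 0 l) 0; first by rewrite mul0r.
have [-> | nz] := eqVneq (N l i) 0; first by rewrite mulr0.
case/eqP: li; apply: uI; apply/eqP; rewrite eqn_leq (tN _ _ nz) andbT.
exact: imax.
Qed.

Lemma triangular_inv u N : injective u -> triangular u N -> N \in unitmx ->
  triangular u (invmx N).
Proof.
move=> uI tN NU i0 j nz0; rewrite leqNgt; apply/negP => lt0.
pose P i := (invmx N i j != 0) && (u i < u j)%N.
have P0 : P i0 by rewrite /P nz0.
case: (arg_minnP u P0) => i /andP[nz lt] imin.
have /matrixP/(_ i j) := mulmxV NU; rewrite !mxE (bigD1 i) //= big1 => [|l li].
  rewrite addr0 (_ : (i == j) = false); last by apply: contraTF lt => /eqP->; rewrite ltnn.
  by move/eqP; rewrite mulf_eq0 (negPf nz) (negPf (triangular_diag uI tN NU i)).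
have [-> | Nil] := eqVneq (N i l) 0; first by rewrite mul0r.
have [-> | nl] := eqVneq (invmx N l j) 0; first by rewrite mulr0.
have ul := tN _ _ Nil; have Pl : P l by rewrite /P nl (leq_ltn_trans ul).
by case/eqP: li; apply: uI; apply/eqP; rewrite eqn_leq ul imin.
Qed.

End Matrices.
Arguments selector {F r n} f.

(** * Matrices of a point of the Grassmannian *)

Section RowSpan.
Variables (k : closedFieldType) (r n : nat).
Implicit Types (A B : 'M[k]_(r, n)) (g : 'M[k]_r).

Lemma mem_row_span (v : 'rV[k]_n) A : (v \in row_span A) = (v <= A)%MS.
Proof.
apply/idP/idP => [| /submxP [u ->]].
  rewrite /row_span -[X in <<X>>%VS]/(tval [tuple of [seq row i A | i : 'I_r]]).
  move/coord_span => ->; apply: summx_sub => i _; apply: scalemx_sub.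
  set s := [tuple of _]; have : s`_i \in s by rewrite mem_nth // size_tuple.
  by case/mapP => l _ ->; apply: row_sub.
rewrite mulmx_sum_row; apply: memv_suml => i _; apply/memvZ/memv_span.
by apply/mapP; exists i; rewrite ?mem_enum.
Qed.

Lemma row_span_mul g A : g \in unitmx -> row_span (g *m A) = row_span A.
Proof.
move=> gU; apply/vspaceP => v; rewrite !mem_row_span.
by rewrite (eqmxMfull A (_ : row_full g)) // row_full_unit.
Qed.

Lemma row_span_eq A B : row_free A -> row_span A = row_span B ->
  exists2 g, g \in unitmx & B = g *m A.
Proof.
move=> fA /vspaceP E.
have /submxP[g gE] : (B <= A)%MS.
  by apply/row_subP => i; rewrite -mem_row_span E mem_row_span row_sub.
have /submxP[h hE] : (A <= B)%MS.
  by apply/row_subP => i; rewrite -mem_row_span -E mem_row_span row_sub.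
exists g => //; have /mulmx1_unit[] // : h *m g = 1%:M.
by apply: (row_free_inj fA); rewrite -mulmxA -gE -hE mul1mx.
Qed.

Lemma dim_row_span A : (\dim (row_span A) == r) = row_free A.
Proof.
pose X := [tuple row i A | i < r].
have -> : (\dim (row_span A) == r) = free X by rewrite /free size_tuple.
have sumE (v : 'rV[k]_r) : \sum_i v 0 i *: X`_i = v *m A.
  rewrite mulmx_sum_row; apply: eq_bigr => i _.
  by rewrite (nth_map i) ?size_enum_ord // nth_ord_enum.
apply/freeP/idP => [H | fA c c0 i].
  apply: inj_row_free => v v0; apply/rowP => i; rewrite mxE.
  by apply: (H (v 0)); rewrite sumE.
have : \row_i c i = 0.
  apply/(row_free_inj fA); rewrite mul0mx -sumE -[RHS]c0.
  by apply: eq_bigr => l _; rewrite mxE.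
by move/rowP/(_ i); rewrite !mxE.
Qed.

Lemma row_span_onto (L : {vspace 'rV[k]_n}) : \dim L == r ->
  exists A, row_span A = L.
Proof.
move/eqP=> dL; exists (\matrix_i (vbasis L)`_i).
rewrite -[RHS](span_basis (vbasisP L)).
congr (<<_>>%VS); apply: (@eq_from_nth _ 0); first by rewrite size_map size_enum_ord size_tuple.
move=> i; rewrite size_map size_enum_ord => ir.
by rewrite (nth_map (Ordinal ir)) ?size_enum_ord // rowK nth_enum_ord.
Qed.

End RowSpan.

(** * Polynomials, rational maps and morphisms *)

Section Polynomials.
Variable k : closedFieldType.

(** If p vanished everywhere, then p + 1 would have no root and be constant. *)
Lemma closed_field_nonroot (p : {poly k}) : p != 0 -> exists t, p.[t] != 0.
Proof.
move=> p0; apply: contrapT => H.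
have r0 t : p.[t] = 0 by apply/eqP/negPn/negP => nz; apply: H; exists t.
case: (closed_rootP (p + 1)) => [[t /rootP] | noroot].
  by rewrite hornerD hornerC r0 add0r => /eqP; rewrite oner_eq0.
have /negP/negPn/size_poly1P [c _ /(canRL (addrK _)) pE] : ~ (size (p + 1) != 1%N).
  by move/closed_rootP.
move: p0 (r0 0); rewrite {}pE -[1]/(1%:P) -polyCB hornerC => p0 c0.
by rewrite c0 eqxx in p0.
Qed.

(** An algebraically closed field is infinite, so that nonempty open subsets of
    the line are dense. *)
Lemma poly_dense (p q : {poly k}) :
  q != 0 -> (forall t, q.[t] != 0 -> p.[t] = 0) -> p = 0.
Proof.
move=> q0 H; apply/eqP/negPn/negP => p0.
have [|t] := @closed_field_nonroot (p * q); first by rewrite mulf_neq0.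
by rewrite hornerM mulf_eq0 negb_or => /andP[pt /H /eqP]; rewrite (negPf pt).
Qed.

Lemma meval_horner m (P : {mpoly k[m]}) (q : 'I_m -> {poly k}) :
  exists p : {poly k}, forall t, p.[t] = P.@[fun i => (q i).[t]].
Proof.
exists (\sum_(c <- msupp P) (P@_c)%:P * \prod_i q i ^+ c i) => t.
rewrite mevalE horner_sum; apply: eq_bigr => c _.
rewrite hornerM hornerC horner_prod; congr (_ * _).
by apply: eq_bigr => i _; rewrite horner_exp.
Qed.

Lemma zariski_closureP (M : coord_space k) (X : set M) (x : M) :
  zariski_closure X x <->
  forall P, (forall y a, X y -> coords M y a -> P.@[a 0] = 0) ->
    forall a, coords M x a -> P.@[a 0] = 0.
Proof.
split=> [clx P P0 a xa | H Z [[S ->] XZ] P SP a xa].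
  pose Z := [set y | forall Q, [set P] Q -> forall b, coords M y b -> Q.@[b 0] = 0].
  apply: (clx Z _ P) => //; split; first by exists [set P].
  by move=> y Xy Q -> b; apply: P0.
by apply: (H P) => // y b /XZ /(_ P SP b).
Qed.

End Polynomials.

Section RationalMaps.
Variable k : closedFieldType.
Variables (M : coord_space k) (X : set M).
Implicit Types h : 'rV[k]_(coord_dim M) -> k.

(** A function of the coordinate vectors of the points of X which is a fraction
    with nowhere vanishing denominator; it need not be constant on the
    coordinate vectors of one point. *)
Definition rational h : Prop :=
  exists P E : {mpoly k[coord_dim M]}, forall x a, X x -> coords M x a ->
    E.@[a 0] != 0 /\ h a = P.@[a 0] / E.@[a 0].

Lemma eq_rational h1 h2 :
  (forall x a, X x -> coords M x a -> h1 a = h2 a) -> rational h2 -> rational h1.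
Proof.
move=> E [P [Q PQ]]; exists P, Q => x a Xx xa.
by rewrite (E x a Xx xa); apply: PQ Xx xa.
Qed.

Lemma rational_poly (P : {mpoly k[coord_dim M]}) : rational (fun a => P.@[a 0]).
Proof. by exists P, 1 => x a _ _; rewrite meval1 oner_eq0 divr1. Qed.

Lemma rational_const c : rational (fun=> c).
Proof. by exists c%:MP, 1 => x a _ _; rewrite mevalC meval1 oner_eq0 divr1. Qed.

Lemma rational_coord i : rational (fun a => a 0 i).
Proof.
apply: eq_rational (rational_poly 'X_i) => x a _ _.
by rewrite mevalXU.
Qed.

Lemma rationalD h1 h2 :
  rational h1 -> rational h2 -> rational (fun a => h1 a + h2 a).
Proof.
move=> [P1 [E1 H1]] [P2 [E2 H2]]; exists (P1 * E2 + P2 * E1), (E1 * E2).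
move=> x a Xx xa; have [n1 ->] := H1 x a Xx xa; have [n2 ->] := H2 x a Xx xa.
by rewrite !(mevalD, mevalM) mulf_neq0 // addf_div.
Qed.

Lemma rationalM h1 h2 :
  rational h1 -> rational h2 -> rational (fun a => h1 a * h2 a).
Proof.
move=> [P1 [E1 H1]] [P2 [E2 H2]]; exists (P1 * P2), (E1 * E2).
move=> x a Xx xa; have [n1 ->] := H1 x a Xx xa; have [n2 ->] := H2 x a Xx xa.
by rewrite !mevalM mulf_neq0 // mulf_div.
Qed.

Lemma rationalV h : (forall x a, X x -> coords M x a -> h a != 0) ->
  rational h -> rational (fun a => (h a)^-1).
Proof.
move=> nz [P [E H]]; exists E, P => x a Xx xa.
have [n1 hE] := H x a Xx xa; have := nz x a Xx xa; rewrite hE mulf_eq0 negb_or.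
by case/andP => -> _; rewrite invf_div.
Qed.

Lemma rational_sum (I : Type) (s : seq I) (H : I -> _) :
  (forall i, rational (H i)) -> rational (fun a => \sum_(i <- s) H i a).
Proof.
move=> rH; elim: s => [|i s IH].
  by apply: eq_rational (rational_const 0) => x a _ _; rewrite big_nil.
apply: eq_rational (rationalD (rH i) IH) => x a _ _; exact: big_cons.
Qed.

Lemma rational_prod (I : Type) (s : seq I) (H : I -> _) :
  (forall i, rational (H i)) -> rational (fun a => \prod_(i <- s) H i a).
Proof.
move=> rH; elim: s => [|i s IH].
  by apply: eq_rational (rational_const 1) => x a _ _; rewrite big_nil.
apply: eq_rational (rationalM (rH i) IH) => x a _ _; exact: big_cons.
Qed.

Lemma rationalX h m : rational h -> rational (fun a => h a ^+ m).
Proof.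
move=> rh; elim: m => [|m IH]; first by apply: eq_rational (rational_const 1) => *; rewrite expr0.
by apply: eq_rational (rationalM rh IH) => x a _ _; rewrite exprS.
Qed.

Lemma rational_meval m (phi : 'rV[k]_(coord_dim M) -> 'rV[k]_m) (P : {mpoly k[m]}) :
  (forall i, rational (fun a => phi a 0 i)) -> rational (fun a => P.@[phi a 0]).
Proof.
move=> rphi; apply: (@eq_rational _
  (fun a => \sum_(c <- msupp P) P@_c * \prod_i phi a 0 i ^+ c i)) => [x a _ _|].
  exact: mevalE.
apply: rational_sum => c; apply: rationalM; first exact: rational_const.
by apply: rational_prod => i; apply: rationalX.
Qed.

(** A map of point sets is a morphism as soon as all coordinate vectors of the
    image points are rational functions of those of the source; a family of
    rational maps is needed because the image points may have several
    coordinate vectors, and regularity refers to all of them. *)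
Lemma rational_morphism (N : coord_space k) (Y : set N) (f : M -> N)
    (Phi : set ('rV[k]_(coord_dim M) -> 'rV[k]_(coord_dim N))) :
  (forall x, X x -> Y (f x)) ->
  (forall x, X x -> exists a, coords M x a) ->
  (forall phi, Phi phi -> forall i, rational (fun a => phi a 0 i)) ->
  (forall phi x a, Phi phi -> X x -> coords M x a -> coords N (f x) (phi a)) ->
  (forall x a b, X x -> coords M x a -> coords N (f x) b ->
     exists2 phi, Phi phi & b = phi a) ->
  morphism X Y f.
Proof.
move=> XY Xc Phir Phic Phis; split.
- by move=> _ [x Xx <-]; apply: XY.
- move=> Z [_ [S ->] ->].
  (* The equations of the preimage are the numerators of the pullbacks. *)
  pose S' := [set Q : {mpoly k[coord_dim M]} | exists P phi E, [/\ S P, Phi phi &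
    forall x a, X x -> coords M x a -> E.@[a 0] != 0 /\ P.@[phi a 0] = Q.@[a 0] / E.@[a 0]]].
  exists [set x | forall P, S' P -> forall a, coords M x a -> P.@[a 0] = 0]; first by exists S'.
  apply/seteqP; split=> x [Xx]; rewrite /=.
    move=> [_ Sx]; split=> // Q [P [phi [E [SP Pphi QE]]]] a xa.
    have [nz] := QE x a Xx xa; rewrite (Sx P SP); last exact: Phic.
    by move/esym/eqP; rewrite mulf_eq0 invr_eq0 (negPf nz) orbF => /eqP.
  move=> S'x; split=> //; split; first exact: XY.
  move=> P SP b fxb; have [a xa] := Xc x Xx.
  have [phi Pphi ->] := Phis x a b Xx xa fxb.
  have [Q [E QE]] := rational_meval P (Phir phi Pphi).
  have [nz ->] := QE x a Xx xa; rewrite (S'x Q) ?mul0r //.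
  by exists P, phi, E.
- move=> x g Xx [P [Q [[b fxb Qb] gPQ]]]; have [a xa] := Xc x Xx.
  have [phi Pphi bE] := Phis x a b Xx xa fxb.
  have [P1 [P2 P12]] := rational_meval P (Phir phi Pphi).
  have [Q1 [Q2 Q12]] := rational_meval Q (Phir phi Pphi).
  exists (P1 * Q2), (P2 * Q1); split.
    exists a => //; have [nz _] := P12 x a Xx xa; have [nz2] := Q12 x a Xx xa.
    move=> E; rewrite mevalM; apply: mulf_neq0 => //.
    by move: Qb; rewrite bE E mulf_eq0 negb_or => /andP[].
  move=> y c Xy yc; have [p2 pE] := P12 y c Xy yc; have [q2 qE] := Q12 y c Xy yc.
  rewrite !mevalM mulf_eq0 negb_or p2 /= => q1.
  rewrite /= (gPQ (f y) (phi c)) ?pE ?qE; first by rewrite invf_div mulf_div.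
  + exact: XY.
  + exact: Phic.
  + by rewrite mulf_neq0 ?invr_eq0.
Qed.

End RationalMaps.

(** * Minors and Schubert varieties *)

Section Plucker.
Variables (k : closedFieldType) (r n : nat).
Implicit Types (A : 'M[k]_(r, n)) (h : 'M[k]_r) (f g : 'I_r -> 'I_n) (L : Gr k r n).

Definition gr_pt A (fA : row_free A) : Gr k r n :=
  exist (fun L : {vspace 'rV[k]_n} => \dim L == r) (row_span A)
    (etrans (dim_row_span A) fA).

Lemma row_free_gr A L : row_span A = val L -> row_free A.
Proof. by move=> E; rewrite -dim_row_span E (valP (L : subspaces k r n)). Qed.

Lemma gr_matrix L : exists A, row_span A = val L.
Proof. exact: row_span_onto (valP (L : subspaces k r n)). Qed.

Lemma gr_coords L : exists a, coords (Gr k r n) L a.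
Proof. by have [A AL] := gr_matrix L; exists (mxvec A); rewrite /= mxvecK. Qed.

Definition generic_mx : 'M[{mpoly k[r * n]}]_(r, n) :=
  \matrix_(i, j) 'X_(mxvec_index i j).

Lemma meval_generic_mx (a : 'rV[k]_(r * n)) :
  map_mx (meval (a 0)) generic_mx = vec_mx a.
Proof. by apply/matrixP => i j; rewrite !mxE mevalXU. Qed.

Definition minor f : {mpoly k[r * n]} := \det (colsub f generic_mx).

Lemma minorE f (a : 'rV[k]_(r * n)) :
  (minor f).@[a 0] = \det (colsub f (vec_mx a)).
Proof. by rewrite /minor -det_map_mx map_mxsub meval_generic_mx. Qed.

Lemma closure_minor (O : set (Gr k r n)) f :
  (forall L A, O L -> row_span A = val L -> colsub f A \notin unitmx) ->
  forall L A, zariski_closure O L -> row_span A = val L -> colsub f A \notin unitmx.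
Proof.
move=> HO L A /zariski_closureP clL AL.
rewrite unitmxE unitfE negbK -[A]mxvecK -minorE; apply/eqP.
apply: clL => [L' a OL' aL' |]; last by rewrite /= mxvecK.
by rewrite minorE; apply/eqP; rewrite -[_ == 0]negbK -unitfE -unitmxE; apply: HO aL'.
Qed.

Lemma orbit_matrix (B : set 'M[k]_n) A0 L A :
  (forall b, B b -> b \in unitmx) ->
  row_free A0 -> orbit_of B (row_span A0) L -> row_span A = val L ->
  exists h b, [/\ h \in unitmx, B b & A = h *m (A0 *m invmx b)].
Proof.
move=> BU f0 [b Bb ->]; rewrite vspace_act_row_span => AE.
have bU := BU b Bb.
have fA : row_free (A0 *m invmx b).
  by rewrite /row_free mxrankMfree // row_free_unit unitmx_inv.
by have [h hU ->] := row_span_eq fA (esym AE); exists h, b.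
Qed.

Lemma row_free_selector f : injective f -> row_free (selector f : 'M[k]_(r, n)).
Proof.
by move=> fI; apply: (unit_colsub_free (g := f)); rewrite colsub_selector ?unitmx1.
Qed.

Lemma mul_selector f (N : 'M[k]_n) i j : (selector f *m N) i j = N (f i) j.
Proof.
rewrite mxE (bigD1 (f i)) //= mxE eqxx mul1r big1 ?addr0 // => l li.
by rewrite mxE (negPf li) mul0r.
Qed.

Lemma coord_subspaceE (I : pred 'I_n) f :
  (forall j, I j = (j \in codom f)) ->
  coord_subspace k I = row_span (selector f).
Proof.
move=> IE; have rowE i : row i (selector f) = delta_mx 0 (f i) :> 'rV[k]_n.
  by apply/rowP => j; rewrite !mxE.
apply/vspaceP => v; apply/idP/idP; apply/subvP; last first.
  apply/span_subvP => _ /mapP[i _ ->]; rewrite rowE memvE.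
  by apply: (sumv_sup (f i)); rewrite ?IE ?codom_f.
apply/subv_sumP => j; rewrite IE => /codomP[i ->].
rewrite -memvE -rowE; apply/memv_span/mapP; exists i => //.
by rewrite mem_enum.
Qed.

Section Schubert.
Variables (u : 'I_n -> nat) (B : set 'M[k]_n) (b : 'I_r -> 'I_n).
Hypotheses (uI : injective u) (bI : injective b).
Hypothesis BE : forall N, B N <-> N \in unitmx /\ triangular u N.

Definition schubert : set (Gr k r n) :=
  zariski_closure (orbit_of (r := r) B (row_span (selector b))).

(** On the orbit itself a nonzero term in the expansion of the minor g provides
    the permutation, and the vanishing of a minor is a closed condition. *)
Lemma schubert_minor L A g : schubert L -> row_span A = val L ->
  colsub g A \in unitmx -> exists s : 'S_r, forall i, (u (g (s i)) <= u (b i))%N.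
Proof.
move=> SL AL; apply: contraPP => none; apply/negP.
apply: (closure_minor _ SL AL) => L' A' OL' AL'; apply/negP => gU; apply: none.
have [h [N [_ /BE[NU tN] AE]]] :=
  orbit_matrix (fun N BN => proj1 (proj1 (BE N) BN)) (row_free_selector bI) OL' AL'.
move: gU; rewrite AE -mulmx_colsub unitmx_mul => /andP[_ /unitmx_transversal[s sP]].
exists s => i; have := sP i; rewrite mxE mul_selector.
exact: triangular_inv.
Qed.

(** Any matrix with the staircase shape of a Schubert cell, possibly with zero
    corners, is the value at 0 of the line through it in the direction of the
    corners, almost all of which lies in the orbit. *)
Lemma schubert_staircase L A : row_span A = val L ->
  (forall i j, A i j != 0 -> (u j <= u (b i))%N) -> schubert L.
Proof.
move=> AL Ab; have fA := row_free_gr AL.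
apply/zariski_closureP => P P0 a aL.
have [h hU hE] := row_span_eq fA (etrans AL (esym aL)).
pose q : {poly k} := \prod_i ((A i (b i))%:P + 'X).
pose coef s := (mxvec (h *m A) 0 s)%:P + (mxvec (h *m selector b) 0 s) *: 'X.
have [p pE] := meval_horner P coef.
have pt t : p.[t] = P.@[mxvec (h *m (A + t *: selector b)) 0].
  rewrite pE; congr (meval _ P); apply/funext => s.
  rewrite !hornerE mulmxDr linearD /= mxE; congr (_ + _).
  by rewrite -scalemxAr linearZ mxE mulrC.
have p0 : p = 0.
  apply: (@poly_dense _ _ q) => [|t].
    apply/prodf_neq0 => i _; rewrite addrC -size_poly_eq0.
    by rewrite -[(_)%:P]opprK -polyCN size_XsubC.
  rewrite horner_prod => /prodf_neq0 qt; rewrite pt.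
  pose C := A + t *: selector b.
  have Cb i : C i (b i) != 0 by have := qt i isT; rewrite !hornerE !mxE eqxx mulr1.
  have Cu i j : C i j != 0 -> (u j <= u (b i))%N.
    rewrite !mxE; have [-> // | jb] := eqVneq j (b i).
    by rewrite mulr0 addr0; apply: Ab.
  (* C completed by unit rows: a triangular matrix that carries k^b to the row
     span of C. *)
  pose N : 'M[k]_n :=
    \matrix_(l, j) if [pick i | b i == l] is Some i then C i j else (l == j)%:R.
  have Nb i j : N (b i) j = C i j.
    by rewrite mxE; case: pickP => [i' /eqP/bI -> // | /(_ i)]; rewrite eqxx.
  have tN : triangular u N.
    move=> l j; rewrite mxE; case: pickP => [i /eqP <- | _]; first exact: Cu.
    by have [-> // | _] := eqVneq l j; rewrite eqxx.
  have NU : N \in unitmx.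
    apply: (triangular_unit uI tN) => l; rewrite mxE.
    by case: pickP => [i /eqP <- | _]; rewrite ?Cb // eqxx oner_eq0.
  have CE : C = selector b *m N by apply/matrixP => i j; rewrite mul_selector Nb.
  have fC : row_free C.
    by rewrite CE /row_free mxrankMfree ?row_free_unit //; apply: row_free_selector.
  apply: (P0 (gr_pt fC)); last by rewrite /= mxvecK row_span_mul.
  exists (invmx N); last by rewrite vspace_act_row_span invmxK /= CE.
  by apply/BE; rewrite unitmx_inv; split => //; apply: triangular_inv.
have := pt 0; rewrite p0 horner0 scale0r addr0 -hE.
by rewrite -[vec_mx a]/(vec_mx a) vec_mxK.
Qed.

End Schubert.

Section Richardson.
Variables a b : 'I_r -> 'I_n.
Hypotheses (ai : increasing a) (bi : increasing b).

Let aI := increasing_inj ai.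
Let bI := increasing_inj bi.
(* The weights for which the lower, resp. upper, triangular matrices are the
   triangular ones. *)
Let low (j : 'I_n) : nat := j.
Let high (j : 'I_n) : nat := (n - j)%N.

Let lowI : injective low.
Proof. by move=> j j' /val_inj. Qed.

Let highI : injective high.
Proof.
move=> j j'; rewrite /high => E; apply/val_inj => /=.
by have := ltn_ord j; have := ltn_ord j'; lia.
Qed.

Lemma B_minusE N : @B_minus k n N <-> N \in unitmx /\ triangular low N.
Proof.
split=> [/andP[-> /is_trig_mxP tN] | [NU tN]].
  split=> // i j; apply: contraNT; rewrite -ltnNge => /tN ->; exact: eqxx.
apply/andP; split=> //; apply/is_trig_mxP => i j; apply: contraTeq => /tN.
by rewrite -leqNgt.
Qed.

Lemma B_plusE N : @B_plus k n N <-> N \in unitmx /\ triangular high N.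
Proof.
split=> [/andP[-> /is_trig_mxP tN] | [NU tN]].
  split=> // i j; apply: contraNT; rewrite /high => lt; have := tN j i; rewrite mxE.
  by move=> -> //; have := ltn_ord j; have := ltn_ord i; lia.
apply/andP; split=> //; apply/is_trig_mxP => i j; rewrite mxE; apply: contraTeq => /tN.
by rewrite /high -leqNgt; have := ltn_ord j; have := ltn_ord i; lia.
Qed.

Definition richardson_of : set (Gr k r n) :=
  schubert (@B_minus k n) b `&` schubert (@B_plus k n) a.

Lemma richardson_minor L A g : richardson_of L -> row_span A = val L ->
  colsub g A \in unitmx -> between a b g.
Proof.
move=> [Lb La] AL gU.
have [s sP] := schubert_minor lowI bI B_minusE Lb AL gU.
have [s' s'P] := schubert_minor highI aI B_plusE La AL gU.
apply/betweenP => x _; apply/andP; split.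
  rewrite -(cnt_perm g s); apply: leq_sum => i _ /=.
  by have := sP i; rewrite /low; case: (ltnP (b i) x) => //= bx gb; rewrite (leq_ltn_trans gb).
rewrite -(cnt_perm g s'); apply: leq_sum => i _ /=; have := s'P i; rewrite /high.
have := ltn_ord (a i); have := ltn_ord (g (s' i)).
by case: (ltnP (a i) x); rewrite ?leq_b1 //; lia.
Qed.

Lemma richardson_band L A : row_span A = val L ->
  (forall i j, A i j != 0 -> (a i <= j <= b i)%N) -> richardson_of L.
Proof.
move=> AL Aab; split.
  by apply: (schubert_staircase lowI bI B_minusE AL) => i j /Aab/andP[].
apply: (schubert_staircase highI aI B_plusE AL) => i j /Aab/andP[+ _].
by rewrite /high; lia.
Qed.

(** The Pluecker coordinates cut out the Richardson variety: the pivots of the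
    two echelon forms of L are nonzero minors. *)
Lemma richardson_of_minors L A : row_span A = val L ->
  (forall g, colsub g A \in unitmx -> between a b g) -> richardson_of L.
Proof.
move=> AL Aok; have fA := row_free_gr AL; split.
  have [h [f [hU fi [f1 fmax]]]] := echelon_form low fA.
  apply: (schubert_staircase lowI bI B_minusE (A := h *m A)).
    by rewrite row_span_mul.
  move=> i j /fmax jf; apply: (leq_trans jf); rewrite /low -ltnS lt_increasing_cnt //.
  have /betweenP/(_ (b i).+1 (ltn_ord _))/andP[+ _] : between a b f.
    by apply: Aok; move: (unitmx1 k r); rewrite -f1 -mulmx_colsub unitmx_mul hU.
  by apply: leq_trans; rewrite -lt_increasing_cnt.
have [h [f [hU fi [f1 fmax]]]] := echelon_form high fA.
apply: (schubert_staircase highI aI B_plusE (A := h *m A)).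
  by rewrite row_span_mul.
move=> i j /fmax jf; apply: (leq_trans jf).
suff : (a i <= f i)%N by rewrite /high; lia.
rewrite -ltnS lt_increasing_cnt //.
have /betweenP/(_ (f i).+1 (ltn_ord _))/andP[_] : between a b f.
  by apply: Aok; move: (unitmx1 k r); rewrite -f1 -mulmx_colsub unitmx_mul hU.
by apply: leq_trans; rewrite -lt_increasing_cnt.
Qed.

End Richardson.
End Plucker.

(** * A dense torus orbit forces a thin strip *)

Section DenseOrbit.
Variables (k : closedFieldType) (r n : nat) (a b : 'I_r -> 'I_n).
Hypotheses (ai : increasing a) (bi : increasing b) (ab : forall i, (a i <= b i)%N).

Lemma invmx_diag (d : 'rV[k]_n) : (forall j, d 0 j != 0) ->
  invmx (diag_mx d) = diag_mx (\row_j (d 0 j)^-1).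
Proof.
move=> d0; have dU : diag_mx d \in unitmx.
  by rewrite unitmxE det_diag unitfE; apply/prodf_neq0 => j _.
have E : diag_mx d *m diag_mx (\row_j (d 0 j)^-1) = 1%:M.
  rewrite mul_diag_mx; apply/matrixP => i j; rewrite !mxE.
  by case: eqP => [-> | _]; rewrite ?mulr1n ?mulr0n ?mulr0 // mulfV.
by rewrite -[LHS]mulmx1 -E mulKmx.
Qed.

Lemma torus_diag (t : 'M[k]_n) :
  torus t -> exists2 d : 'rV[k]_n, (forall j, d 0 j != 0) & invmx t = diag_mx d.
Proof.
move=> /andP[tU /diag_mxP[c tE]].
have c0 j : c 0 j != 0.
  move: tU; rewrite tE unitmxE det_diag unitfE => /prodf_neq0; exact.
exists (\row_j (c 0 j)^-1) => [j|]; first by rewrite mxE invr_eq0.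
by rewrite tE invmx_diag.
Qed.

Lemma det_colsub_diag (A : 'M[k]_(r, n)) (d : 'rV[k]_n) g :
  \det (colsub g (A *m diag_mx d)) = \det (colsub g A) * \prod_i d 0 (g i).
Proof.
have -> : colsub g (A *m diag_mx d) = colsub g A *m diag_mx (\row_i d 0 (g i)).
  by rewrite !mul_mx_diag; apply/matrixP => i j; rewrite !mxE.
by rewrite det_mulmx det_diag; congr (_ * _); apply: eq_bigr => i _; rewrite mxE.
Qed.

Lemma meval_quadric m (v : 'I_m -> k) (c d : k) (P1 P2 P3 P4 : {mpoly k[m]}) :
  (c%:MP * (P1 * P2) - d%:MP * (P3 * P4)).@[v] =
  c * (P1.@[v] * P2.@[v]) - d * (P3.@[v] * P4.@[v]).
Proof. by rewrite mevalB !mevalM !mevalC. Qed.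

(** A 2 x 2 square of the skew shape gives four consecutive columns such that
    the Richardson variety contains a copy of Gr(2, 4) on them; a monomial
    relation between Pluecker coordinates that holds along a torus orbit fails
    on that copy. *)
Lemma dense_orbit_thin : has_dense_torus_orbit (richardson_of (k := k) a b) ->
  forall x, (x <= n)%N -> (cnt a x <= (cnt b x).+1)%N.
Proof.
move=> [L0 RL0 dense] x xn; rewrite leqNgt; apply/negP => thick.
(* With h = cnt b x, the paths with north steps at two of the columns x-2, x-1,
   x, x+1 in the rows h and h+1, and following a before and b after, all stay
   between a and b. *)
have ar := cnt_le a x.
have h1 : ((cnt b x).+1 < r)%N by lia.
have [i1 i1E] : {i : 'I_r | i = (cnt b x).+1 :> nat} by exists (Ordinal h1).
have [i0 i0E] : {i : 'I_r | i = cnt b x :> nat} by exists (Ordinal (ltnW h1)).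
have ax : (a i1 < x)%N by rewrite lt_increasing_cnt // i1E.
have bx : (x <= b i0)%N by rewrite leqNgt lt_increasing_cnt // i0E ltnn.
have ainc := increasingP _ ai; have binc := increasingP _ bi.
have i01 : (i0 < i1)%N by rewrite i0E i1E.
have a01 := ainc i0 i1 i01; have b01 := binc i0 i1 i01.
have bn := ltn_ord (b i1).
have col (y : nat) : (y < 4)%N -> {c : 'I_n | c = (x - 2 + y)%N :> nat}.
  by move=> y4; have cn : (x - 2 + y < n)%N; [lia | exists (Ordinal cn)].
have [c0 c0E] := col 0%N isT; have [c1 c1E] := col 1%N isT.
have [c2 c2E] := col 2%N isT; have [c3 c3E] := col 3%N isT.
pose F (p q : 'I_n) (i : 'I_r) : 'I_n :=
  if i == i0 then p else if i == i1 then q else if (i < i0)%N then a i else b i.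
have i10 : (i1 == i0) = false by apply/eqP => /(congr1 val) /=; lia.
have F0 p q : F p q i0 = p by rewrite /F eqxx.
have F1 p q : F p q i1 = q by rewrite /F i10 eqxx.
have Fout p q p' q' i : i != i0 -> i != i1 -> F p q i = F p' q' i.
  by rewrite /F => /negPf -> /negPf ->.
have Fsmall p q (i : 'I_r) : (i < i0)%N -> F p q i = a i.
  by move=> lt; rewrite /F lt; do 2![case: eqP => [E|_]; first by move: lt; rewrite E /=; lia].
have Fbig p q (i : 'I_r) : (i1 < i)%N -> F p q i = b i.
  move=> lt; rewrite /F ltnNge [(i0 <= i)%N]ltnW; last by move: lt => /=; lia.
  by do 2![case: eqP => [E|_]; first by move: lt; rewrite E /=; lia].
have Icase (i : 'I_r) : [\/ (i < i0)%N, i = i0, i = i1 | (i1 < i)%N].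
  case: (ltngtP i i0) => [lt | gt | /val_inj ->]; [exact: Or41 | | exact: Or42].
  case: (ltngtP i i1) => [lt | lt | /val_inj ->]; [| exact: Or44 | exact: Or43].
  by move: lt gt => /=; lia.
have Finc (p q : 'I_n) : (c0 <= p)%N -> (p < q)%N -> (q <= c3)%N -> increasing (F p q).
  move=> p0 pq q3; apply/increasingP => i l il.
  case: (Icase i) (Icase l) il => [lti|->|->|gti] [ltl|->|->|gtl] il;
    rewrite ?F0 ?F1 ?(Fsmall _ _ _ lti) ?(Fsmall _ _ _ ltl);
    rewrite ?(Fbig _ _ _ gti) ?(Fbig _ _ _ gtl) //;
    try (by lia); try (by apply: ainc); try (by apply: binc);
    try (have := ainc _ _ lti); try (have := binc _ _ gtl); lia.
have Fin (p q : 'I_n) i : (c0 <= p)%N -> (p <= c2)%N -> (c1 <= q)%N -> (q <= c3)%N ->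
    (a i <= F p q i <= b i)%N.
  move=> p0 p2 q1 q3; case: (Icase i) => [lt|->|->|gt];
    rewrite ?F0 ?F1 ?(Fsmall _ _ _ lt) ?(Fbig _ _ _ gt) ?leqnn ?ab //;
    move: p0 p2 q1 q3 => /=; lia.
have [A0 A0L] := gr_matrix L0.
(* A minor that vanishes at A0 vanishes along the orbit, hence on all of R, but
   the minor F p q is 1 at the coordinate subspace of F p q. *)
have nz (p q : 'I_n) : (c0 <= p)%N -> (p < q)%N -> (q <= c3)%N ->
    (p <= c2)%N -> (c1 <= q)%N ->
    \det (colsub (F p q) A0) != 0.
  move=> p0 pq q3 p2 q1; rewrite -unitfE -unitmxE; apply: contraT => not_unit.
  have FI := increasing_inj (Finc p q p0 pq q3).
  have fS := row_free_selector k FI.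
  have RS : richardson_of (k := k) a b (gr_pt fS).
    apply: (richardson_band ai bi (A := selector (F p q))) => // i j.
    by rewrite mxE; case: (j =P F p q i) => [-> _ | _]; [apply: Fin | rewrite eqxx].
  have : colsub (F p q) (selector (F p q) : 'M[k]_(r, n)) \notin unitmx.
    apply: (closure_minor _ (dense _ RS)) => // L A OL AL.
    have [h [t [hU tT ->]]] := orbit_matrix (B := torus (k := k) (n := n))
      (fun t tt => proj1 (andP tt)) (row_free_gr A0L)
      (eq_ind_r (fun V => orbit_of _ V L) OL A0L) AL.
    have [d d0 ->] := torus_diag tT.
    rewrite -mulmx_colsub unitmx_mul hU unitmxE det_colsub_diag unitfE.
    by move: not_unit; rewrite unitmxE unitfE negbK => /eqP ->; rewrite mul0r eqxx.
  by rewrite colsub_selector // unitmx1.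
(* Along the orbit of A0 the polynomial P is a multiple of its value at A0, which
   is zero by the choice of the coefficients. *)
pose D p q := \det (colsub (F p q) A0).
pose P := (D c0 c2 * D c1 c3)%:MP * (minor k (F c0 c1) * minor k (F c2 c3)) -
          (D c0 c1 * D c2 c3)%:MP * (minor k (F c0 c2) * minor k (F c1 c3)).
have PE (A : 'M[k]_(r, n)) : P.@[mxvec A 0] =
    D c0 c2 * D c1 c3 * (\det (colsub (F c0 c1) A) * \det (colsub (F c2 c3) A)) -
    D c0 c1 * D c2 c3 * (\det (colsub (F c0 c2) A) * \det (colsub (F c1 c3) A)).
  by rewrite /P meval_quadric !minorE mxvecK.
(* On M the minors (c0, c1) and (c2, c3) are 1, while (c0, c2) vanishes because
   these two columns are equal. *)
pose M : 'M[k]_(r, n) := \matrix_(i, j) ((j == F c0 c1 i) || (j == F c2 c3 i))%:R.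
have I01 := increasing_inj (Finc c0 c1 ltac:(by []) ltac:(rewrite /=; lia) ltac:(rewrite /=; lia)).
have I23 := increasing_inj (Finc c2 c3 ltac:(rewrite /=; lia) ltac:(rewrite /=; lia) ltac:(by [])).
have cross i l : F c0 c1 i = F c2 c3 l -> i = l.
  have [i_out | i_in] := boolP ((i != i0) && (i != i1)).
    by case/andP: i_out => o1 o2; rewrite (Fout c0 c1 c2 c3) // => /I23.
  have [l_out | l_in] := boolP ((l != i0) && (l != i1)).
    by case/andP: l_out => o1 o2; rewrite (Fout c2 c3 c0 c1) // => /I01.
  move: i_in l_in; rewrite !negb_and !negbK.
  by case/orP=> /eqP->; case/orP=> /eqP->; rewrite ?F0 ?F1 => // /(congr1 val) /=; lia.
have M01 : colsub (F c0 c1) M = 1%:M.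
  apply/matrixP => i l; rewrite !mxE (inj_eq I01) eq_sym.
  by case: (F c0 c1 l =P F c2 c3 i) => [/cross -> | _]; rewrite ?eqxx ?orbF.
have M23 : colsub (F c2 c3) M = 1%:M.
  apply/matrixP => i l; rewrite !mxE (inj_eq I23) [X in _ || X]eq_sym orbC.
  by case: (F c2 c3 l =P F c0 c1 i) => [/esym/cross -> | _]; rewrite ?eqxx ?orbF.
have M02 : \det (colsub (F c0 c2) M) = 0.
  rewrite -det_tr; apply: (determinant_alternate (i1 := i0) (i2 := i1)).
    by rewrite eq_sym i10.
  move=> l; rewrite !mxE F0 F1; congr (_%:R); congr nat_of_bool.
  have -> : (c0 == F c0 c1 l) = (l == i0) by rewrite -(inj_eq I01 l) F0 eq_sym.
  have -> : (c2 == F c2 c3 l) = (l == i0) by rewrite -(inj_eq I23 l) F0 eq_sym.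
  have -> : (c0 == F c2 c3 l) = false.
    by apply/eqP => E; have := cross i0 l; rewrite F0 => /(_ E) E'; move: E;
      rewrite -E' F0 => /(congr1 val) /=; lia.
  have -> : (c2 == F c0 c1 l) = false.
    by apply/eqP => E; have := cross l i0; rewrite F0 => /(_ (esym E)) E'; move: E;
      rewrite E' F0 => /(congr1 val) /=; lia.
  by rewrite orbF.
have fM : row_free M by apply: (unit_colsub_free (g := F c0 c1)); rewrite M01 unitmx1.
have RM : richardson_of (k := k) a b (gr_pt fM).
  apply: (richardson_band ai bi (A := M)) => // i j.
  rewrite mxE; case: (j =P F c0 c1 i) => [-> _ | _]; first by apply: Fin => /=; lia.
  case: (j =P F c2 c3 i) => [-> _ | _]; first by apply: Fin => /=; lia.
  by rewrite eqxx.
have : P.@[mxvec M 0] = 0.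
  move/zariski_closureP: (dense _ RM) => /(_ P) H; apply: H; last by rewrite /= mxvecK.
  move=> L v OL vL; rewrite -[v]vec_mxK PE.
  have [h [t [hU tT ->]]] := orbit_matrix (B := torus (k := k) (n := n))
    (fun t tt => proj1 (andP tt)) (row_free_gr A0L)
    (eq_ind_r (fun V => orbit_of _ V L) OL A0L) vL.
  have [d d0 ->] := torus_diag tT.
  have dF p q : \prod_i d 0 (F p q i) =
      d 0 p * (d 0 q * \prod_(i | (i != i0) && (i != i1)) d 0 (F c0 c1 i)).
    rewrite (bigD1 i0) //= F0; congr (_ * _).
    rewrite (bigD1 i1) ?i10 //= F1; congr (_ * _).
    by apply: eq_bigr => i /andP[o1 o2]; congr (d 0 _); apply: Fout.
  have detE p q : \det (colsub (F p q) (h *m (A0 *m diag_mx d))) =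
      \det h * (D p q * \prod_i d 0 (F p q i)).
    by rewrite -mulmx_colsub det_mulmx det_colsub_diag.
  rewrite !detE !dF; ring.
rewrite PE M01 M23 M02 !det1 mul0r mulr0 subr0 !mulr1 => /eqP.
rewrite mulf_eq0 => /orP[] /eqP E.
  by have := nz c0 c2; rewrite -/(D c0 c2) E eqxx => H; apply: notF; apply: H => /=; lia.
by have := nz c1 c3; rewrite -/(D c1 c3) E eqxx => H; apply: notF; apply: H => /=; lia.
Qed.

End DenseOrbit.

(** * North steps of a partition *)

Section NorthSteps.
Local Open Scope nat_scope.
Variables (r n : nat).
Hypothesis le_rn : r <= n.

(** The abscissa of a north step is a part of the partition, and its index also
    counts the north steps that precede it. *)
Lemma nth_steps s x p : sorted leq (x :: s) ->
  nth false (steps r n s x) p -> exists2 l, l < size s & p + x = nth 0 s l + l.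
Proof.
elim: s x p => [|c s IH] x p /=; first by rewrite nth_nseq if_same.
case/andP=> xc sc; rewrite nth_cat size_nseq nth_nseq.
case: ltnP => // cp; case E : (p - (c - x)) => [|q] /=; first by exists 0 => //=; lia.
by case/IH => // l ls lE; exists l.+1 => //=; lia.
Qed.

Lemma steps_nth s x p l : sorted leq (x :: s) -> l < size s ->
  p + x = nth 0 s l + l -> nth false (steps r n s x) p.
Proof.
elim: s x p l => [|c s IH] x p l //= /andP[xc sc] ls pE.
rewrite nth_cat size_nseq nth_nseq.
case: l ls pE => [|l] /= ls pE.
  have -> : (p < c - x) = false by lia.
  by have -> : p - (c - x) = 0 by lia.
have cl : c <= nth 0 s l.
  by apply: (allP (order_path_min leq_trans sc)); rewrite mem_nth.
have -> : (p < c - x) = false by lia.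
have -> /= : p - (c - x) = (p - (c - x)).-1.+1 by lia.
by apply: (IH _ _ l) => //; lia.
Qed.

Lemma partition_steps la : partition_in_box r n la ->
  exists b : 'I_r -> 'I_n,
    [/\ increasing b, forall i, b i = nth 0 la (r - i.+1) + i :> nat &
        forall j, north_steps r la j = (j \in codom b)].
Proof.
case/and3P=> /eqP sz srt /allP box.
have nthE i : i < r -> nth 0 (rev la) i = nth 0 la (r - i.+1).
  by move=> ir; rewrite nth_rev sz.
have sr : sorted leq (0 :: rev la).
  have : sorted leq (rev la) by rewrite rev_sorted.
  by case: (rev la).
have bP (i : 'I_r) : nth 0 la (r - i.+1) + i < n.
  have /box : nth 0 la (r - i.+1) \in la by rewrite mem_nth // sz; have := ltn_ord i; lia.
  by have := ltn_ord i; lia.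
exists (fun i => Ordinal (bP i)); split=> //.
  apply/increasingP => i l il /=; rewrite -!nthE //.
  suff : nth 0 (rev la) i <= nth 0 (rev la) l by lia.
  apply: (sorted_leq_nth leq_trans leqnn) => //; rewrite ?inE ?size_rev ?sz ?ltn_ord //.
  - by move: sr => /path_sorted.
  - exact: ltnW.
move=> j; apply/idP/codomP => [/(nth_steps sr)[l] | [i ->]].
  rewrite size_rev sz addn0 => lr jE; exists (Ordinal lr).
  by apply/val_inj; rewrite /= jE nthE.
apply: (steps_nth (l := i)) => //; first by rewrite size_rev sz.
by rewrite addn0 nthE.
Qed.

End NorthSteps.

(** * The cells *)

Section MorphismsToGr.
Variables (k : closedFieldType) (r n : nat).

(** The coordinate vectors of the image point are the h *m F a for h in GL_r. *)
Lemma morphism_to_gr (M : coord_space k) (X : set M) (Y : set (Gr k r n))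
    (f : M -> Gr k r n) (F : 'rV[k]_(coord_dim M) -> 'M[k]_(r, n)) :
  (forall x, X x -> Y (f x)) ->
  (forall x, X x -> exists a, coords M x a) ->
  (forall i j, rational X (fun a => F a i j)) ->
  (forall x a, X x -> coords M x a -> row_span (F a) = val (f x)) ->
  morphism X Y f.
Proof.
move=> XY Xc rF FE.
pose Phi := [set phi : 'rV[k]_(coord_dim M) -> 'rV[k]_(r * n) |
  exists2 h : 'M[k]_r, h \in unitmx & phi = fun a => mxvec (h *m F a)].
apply: (@rational_morphism _ _ _ (Gr k r n) _ _ Phi) => //.
- move=> _ [h _ ->] s; case/mxvec_indexP: s => i j.
  apply: (@eq_rational _ _ _ _ (fun a => \sum_l h i l * F a l j)) => [x a _ _|].
    by rewrite mxvecE mxE.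
  by apply: rational_sum => l; apply: rationalM => //; apply: rational_const.
- by move=> _ x a [h hU ->] Xx xa; rewrite /= mxvecK row_span_mul // (FE x).
- move=> x a b Xx xa /= bE; have xE := FE x a Xx xa.
  have [h hU hE] := row_span_eq (row_free_gr xE) (etrans xE (esym bE)).
  exists (fun a => mxvec (h *m F a)); first by exists h.
  by rewrite -hE vec_mxK.
Qed.

End MorphismsToGr.

Section Cells.
Variables (k : closedFieldType) (r n : nat) (a b : 'I_r -> 'I_n).
Hypotheses (ai : increasing a) (bi : increasing b).
Hypothesis thin : forall x, (x <= n)%N -> (cnt a x <= (cnt b x).+1)%N.
Implicit Types (A : 'M[k]_(r, n)) (L : Gr k r n).

Local Notation w := (weight b).
Local Notation R := (richardson_of (k := k) a b).

(** A reduced matrix with pivots f may only have a nonzero entry (i, j) where j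
    is lighter than the pivot, which is what the flow contracts, and where the
    exchange of f i for j leads to a fixed point of the Richardson variety, as
    the entry is a Pluecker coordinate up to sign. No relation is imposed
    between these entries. *)
Definition in_cell (f : 'I_r -> 'I_n) A : Prop :=
  colsub f A = 1%:M /\
  forall i j, A i j != 0 -> (w j <= w (f i))%N && between a b (upd f i j).

Definition cell f : set (Gr k r n) :=
  [set L | exists2 A, row_span A = val L & in_cell f A].

Lemma in_cell_echelon f A : in_cell f A -> echelon w f A.
Proof. by case=> f1 H; split=> // i j /H/andP[]. Qed.

Lemma in_cell_free f A : in_cell f A -> row_free A.
Proof. by case=> f1 _; apply: (unit_colsub_free (g := f)); rewrite f1 unitmx1. Qed.

(** The shape of the matrices of the cell suffices: in the expansion of any
    nonzero minor a nonzero term is a transversal of the cell. *)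
Lemma cell_richardson f : increasing f -> between a b f -> cell f `<=` R.
Proof.
move=> fi fab L [A AL [f1 Acell]]; apply: (richardson_of_minors ai bi AL) => g gU.
have [s sP] := unitmx_transversal gU.
rewrite -(between_perm _ _ _ s).
have fI := increasing_inj fi.
have GI : injective (g \o s) by apply: inj_comp (colsub_unit_inj gU) (@perm_inj _ s).
have Gcell i : A i ((g \o s) i) != 0 by have := sP i; rewrite mxE.
have Gw i := proj1 (andP (Acell _ _ (Gcell i))).
have Gok i := proj2 (andP (Acell _ _ (Gcell i))).
have Gf i l : (g \o s) i = f l -> i = l.
  move=> E; have := Gcell i; rewrite E (colsub1E _ _ f1).
  by case: (i =P l) => // _; rewrite eqxx.
apply/betweenP => x xn; apply/andP; split.
  exact: (transversal_lower fI thin fab Gw Gok xn).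
exact: (transversal_upper GI thin fab Gw Gok Gf xn).
Qed.

Lemma richardson_cell L : R L ->
  exists f, [/\ increasing f, between a b f & cell f L].
Proof.
move=> RL; have [A AL] := gr_matrix L.
have [h [f [hU fi [f1 fmax]]]] := echelon_form w (row_free_gr AL).
have hAL : row_span (h *m A) = val L by rewrite row_span_mul.
exists f; split=> //.
  by apply: (richardson_minor ai bi RL hAL); rewrite f1 unitmx1.
exists (h *m A) => //; split=> // i j nz; rewrite fmax //=.
exact: (richardson_minor ai bi RL hAL (colsub_upd_unit f1 nz)).
Qed.

Lemma in_cell_selector f : injective f -> between a b f ->
  in_cell f (selector f).
Proof.
move=> fI fab; split; first exact: colsub_selector.
move=> i j; rewrite mxE; have [-> _ | _] := eqVneq j (f i); last by rewrite eqxx.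
rewrite leqnn (@eq_between _ _ _ _ _ f) // => l.
by rewrite /upd; case: eqP => [->|].
Qed.

(** ** Torus action *)

Lemma torus_cell f L A t : torus t -> row_span A = val L -> in_cell f A ->
  exists2 d : 'rV[k]_n, (forall j, d 0 j != 0) & invmx t = diag_mx d /\
    let A' := \matrix_(i, j) ((d 0 (f i))^-1 * A i j * d 0 j) in
    in_cell f A' /\ row_span A' = val (gr_act t L).
Proof.
move=> tT AL [f1 Af]; have [d d0 dE] := torus_diag tT.
exists d => //; split=> // A'; have tU : t \in unitmx by case/andP: tT.
split.
  split.
    apply/matrixP => i l; rewrite !mxE (colsub1E _ _ f1).
    by case: eqP => [-> | _]; rewrite ?mulr0 ?mul0r // mulr1 mulVf.
  by move=> i j; rewrite mxE !mulf_eq0 !negb_or -andbA => /and3P[_ /Af].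
rewrite gr_actE // -AL vspace_act_row_span dE.
have -> : A' = diag_mx (\row_i (d 0 (f i))^-1) *m (A *m diag_mx d).
  by rewrite mul_diag_mx mul_mx_diag; apply/matrixP => i j; rewrite !mxE mulrA.
rewrite row_span_mul // unitmxE det_diag unitfE.
by apply/prodf_neq0 => i _; rewrite mxE invr_eq0.
Qed.

Lemma cell_torus_invariant f : torus_invariant (cell f).
Proof.
move=> t L tT [A AL Af]; have [d _ [_ [H E]]] := torus_cell tT AL Af.
by eexists; [exact: E | exact: H].
Qed.

Definition one_param (t : k) : 'M[k]_n := diag_mx (\row_j t ^+ w j).

Lemma one_param_torus t : t != 0 -> torus (one_param t).
Proof.
move=> t0; apply/andP; split; last exact: diag_mx_is_diag.
by rewrite unitmxE det_diag unitfE; apply/prodf_neq0 => j _; rewrite mxE expf_neq0.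
Qed.

Lemma one_param_subgroup : one_parameter_subgroup one_param.
Proof.
split; last first.
  move=> s t _ _; rewrite /one_param mul_diag_mx; apply/matrixP => i j; rewrite !mxE.
  by case: eqP => _; rewrite ?mulr1n ?mulr0n ?mulr0 // exprMn.
pose phi (c : 'rV[k]_1) := mxvec (one_param (c 0 0)).
apply: (@rational_morphism k (affine_line k) Gm (matrix_space k n) _ one_param [set phi]).
- exact: one_param_torus.
- by move=> t _; exists (const_mx t).
- move=> _ -> s; case/mxvec_indexP: s => i j.
  apply: (@eq_rational _ _ _ _
    (fun c : 'rV[k]_(coord_dim (affine_line k)) => (c 0 (0 : 'I_1)) ^+ w i * (i == j)%:R)).
    by move=> x c _ _; rewrite /phi mxvecE !mxE mulr_natr.
  apply: rationalM; last exact: rational_const.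
  by apply/rationalX/rational_coord.
- by move=> _ t _ -> _ ->; rewrite /phi /= mxE.
- by move=> t _ c _ -> ->; exists phi => //; rewrite /phi mxE.
Qed.

(** The matrix of the translate of a point of the cell, renormalized on the
    pivots: all exponents are nonnegative, so that it extends to t = 0. *)
Definition flow (f : 'I_r -> 'I_n) A (t : k) : 'M[k]_(r, n) :=
  \matrix_(i, j) (A i j * t ^+ (w (f i) - w j)).

Lemma in_cell_flow f A t : in_cell f A -> in_cell f (flow f A t).
Proof.
case=> f1 Af; split.
  apply/matrixP => i l; rewrite !mxE (colsub1E _ _ f1).
  by case: eqP => [-> | _]; rewrite ?mul0r // subnn mulr1.
by move=> i j; rewrite mxE mulf_eq0 negb_or => /andP[/Af].
Qed.

Lemma row_span_flow f L A t : t != 0 -> row_span A = val L -> in_cell f A ->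
  row_span (flow f A t) = val (gr_act (one_param t) L).
Proof.
move=> t0 AL Af; have [d d0 [dE [_ <-]]] := torus_cell (one_param_torus t0) AL Af.
congr row_span; apply/matrixP => i j; rewrite !mxE.
have dE' l : d 0 l = t ^- w l.
  move: dE; rewrite invmx_diag => [/matrixP/(_ l l) | l']; last by rewrite mxE expf_neq0.
  by rewrite !mxE eqxx !mulr1n.
rewrite !dE' invrK; have [-> | nz] := eqVneq (A i j) 0; first by rewrite mulr0 !mul0r.
have /andP[le _] := proj2 Af i j nz.
have -> : t ^+ w (f i) = t ^+ (w (f i) - w j) * t ^+ w j by rewrite -exprD subnK.
by rewrite mulrAC mulfK ?expf_neq0 // mulrC.
Qed.

Lemma flow0 f A : in_cell f A -> flow f A 0 = selector f.
Proof.
case=> f1 Af; apply/matrixP => i j; rewrite !mxE.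
have [-> | jf] := eqVneq j (f i); first by rewrite (colsub1E _ _ f1) eqxx subnn mulr1.
have [-> | /Af/andP[le _]] := eqVneq (A i j) 0; first by rewrite mul0r.
rewrite expr0n subn_eq0 leqNgt ltn_neqAle le andbT.
by rewrite (inj_eq (@weight_inj _ _ b)) jf mulr0.
Qed.

Definition flow_poly (f : 'I_r -> 'I_n) A : 'M[{poly k}]_(r, n) :=
  \matrix_(i, j) ((A i j)%:P * 'X^(w (f i) - w j)).

Lemma flow_polyE f A t s : (mxvec (flow_poly f A) 0 s).[t] = mxvec (flow f A t) 0 s.
Proof. by case/mxvec_indexP: s => i j; rewrite !mxvecE !mxE !hornerE. Qed.

(** ** Fixed points and limits *)

Definition pivots := {f : {ffun 'I_r -> 'I_n} | increasing f && between a b f}.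

Definition pivot_inj (f : pivots) : injective (val f) :=
  increasing_inj (proj1 (andP (valP f))).

Definition pivot_pt (f : pivots) : Gr k r n :=
  gr_pt (row_free_selector k (@pivot_inj f)).

Lemma pivots_eq (f g : pivots) : val f =1 val g -> f = g.
Proof. by move=> E; apply/val_inj/ffunP. Qed.

Lemma richardson_pivots L : R L -> exists f : pivots, cell (val f) L.
Proof.
move=> /richardson_cell [f [fi fab [A AL [f1 Af]]]].
have fE : [ffun i => f i] =1 f by move=> i; rewrite ffunE.
have ok : increasing [ffun i => f i] && between a b [ffun i => f i].
  rewrite (eq_between _ _ fE) fab andbT; apply/increasingP => i l il.
  by rewrite !fE (increasingP _ fi).
exists (exist (fun f : {ffun 'I_r -> 'I_n} => increasing f && between a b f) _ ok).
exists A => //; split; first by rewrite /= (eq_colsub _ fE).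
move=> i j /Af /=; rewrite fE.
by rewrite (@eq_between _ _ _ _ (upd f i j) (upd [ffun i => f i] i j)) // => l; rewrite /upd fE.
Qed.

Lemma pivots_cell (f : pivots) : cell (val f) `<=` R.
Proof. by have /andP[fi fab] := valP f; apply: cell_richardson. Qed.

Lemma cell_pivot_pt (f : pivots) : cell (val f) (pivot_pt f).
Proof.
exists (selector (val f)) => //; apply: in_cell_selector (@pivot_inj f) _.
by case/andP: (valP f).
Qed.

Lemma pivot_minor (f g : pivots) :
  colsub (val g) (selector (val f) : 'M[k]_(r, n)) \in unitmx -> f = g.
Proof.
move=> /unitmx_transversal [s sP]; apply: pivots_eq.
have /andP[fi _] := valP f; have /andP[gi _] := valP g.
apply: (increasing_eq (s := s)) => // i; apply/eqP.
by apply: contraNT (sP i) => /negPf E; rewrite !mxE E.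
Qed.

Lemma cell_dominant (f g : pivots) L A : cell (val f) L -> row_span A = val L ->
  colsub (val g) A \in unitmx ->
  (\sum_i w (val g i) <= \sum_i w (val f i))%N /\
  ((\sum_i w (val f i) <= \sum_i w (val g i))%N -> f = g).
Proof.
move=> [A' AL' Af'] AL gU.
have [h hU AE] := row_span_eq (row_free_gr AL') (etrans AL' (esym AL)).
have gU' : colsub (val g) A' \in unitmx.
  by move: gU; rewrite AE -mulmx_colsub unitmx_mul => /andP[].
have ech := in_cell_echelon Af'; split; first exact: echelon_dominant ech gU'.
move=> le; apply: pivots_eq; have /andP[fi _] := valP f; have /andP[gi _] := valP g.
exact: echelon_pivots (@weight_inj _ _ b) fi gi ech gU' le.
Qed.

Lemma pivot_pt_inj : injective pivot_pt.
Proof.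
move=> f g E; apply: pivot_minor.
have fg : row_span (selector (val g)) = row_span (selector (val f)) :> {vspace 'rV[k]_n}.
  by move/(congr1 val): E.
have [h hU ->] := row_span_eq (row_free_selector k (@pivot_inj g)) fg.
by rewrite -mulmx_colsub unitmx_mul hU colsub_selector ?unitmx1 //; apply: pivot_inj.
Qed.

(** A fixed point has a constant flow, also at t = 0 by density. *)
Lemma cell_fixed (f : pivots) L : cell (val f) L ->
  (forall t, t != 0 -> gr_act (one_param t) L = L) -> L = pivot_pt f.
Proof.
move=> [A AL Af] fix_L; apply/val_inj => /=; rewrite -AL; congr row_span.
have flowE t : t != 0 -> flow (val f) A t = A.
  move=> t0; have := row_span_flow t0 AL Af; rewrite fix_L // -AL.
  move=> /esym/(row_span_eq (in_cell_free Af)) [h _ hE].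
  suff h1 : h = 1%:M by rewrite hE h1 mul1mx.
  have [f1 _] := in_cell_flow t Af; move: f1.
  by rewrite hE -mulmx_colsub (proj1 Af) mulmx1.
rewrite -(flow0 Af); apply/matrixP => i j; apply/eqP; rewrite eq_sym -subr_eq0.
pose p := (A i j)%:P * 'X^(w (val f i) - w j) - (A i j)%:P.
have pE t : p.[t] = flow (val f) A t i j - A i j by rewrite mxE /p !hornerE.
rewrite -pE (_ : p = 0) ?horner0 //; apply: (@poly_dense _ _ 'X) => [|t].
  by rewrite polyX_eq0.
by rewrite hornerX => t0; rewrite pE flowE // subrr.
Qed.

Lemma pivot_pt_fixed (f : pivots) t : t != 0 ->
  gr_act (one_param t) (pivot_pt f) = pivot_pt f.
Proof.
move=> t0; apply/val_inj.
have /andP[_ fab] := valP f; have sf := in_cell_selector (@pivot_inj f) fab.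
rewrite -(row_span_flow (A := selector (val f)) t0 _ sf) //=.
congr row_span; apply/matrixP => i j; rewrite !mxE.
by have [-> | _] := eqVneq j (val f i); rewrite ?subnn ?mulr1 ?mul0r.
Qed.

Lemma cell_limit (f : pivots) L : cell (val f) L ->
  limit0 R (fun t => gr_act (one_param t) L) (pivot_pt f).
Proof.
move=> [A AL Af].
pose psi (t : affine_line k) := gr_pt (in_cell_free (in_cell_flow t Af)).
exists psi; split.
- apply: (@morphism_to_gr _ _ _ _ _ _ _
    (fun c : 'rV[k]_(coord_dim (affine_line k)) => flow (val f) A (c 0 (0 : 'I_1)))).
  + move=> t _; apply: (@pivots_cell f).
    by exists (flow (val f) A t) => //; apply: in_cell_flow.
  + by move=> t _; exists (const_mx t).
  + move=> i j; apply: (@eq_rational _ _ _ _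
      (fun c : 'rV[k]_(coord_dim (affine_line k)) =>
         A i j * (c 0 (0 : 'I_1)) ^+ (w (val f i) - w j))).
      by move=> x c _ _; rewrite mxE.
    apply: rationalM; first exact: rational_const.
    by apply/rationalX/rational_coord.
  + by move=> t _ _ ->; rewrite mxE.
- by move=> t t0; apply/val_inj; rewrite -(row_span_flow t0 AL Af).
- by apply/val_inj => /=; rewrite flow0.
Qed.

(** If the limit were k^g, then the ratio of the minors f and g,
    extended by 1 where the minor g vanishes, would be regular near it with
    value 0; along the flow this ratio is the inverse of a minor which vanishes
    at t = 0. *)
Lemma limit_cell (f g : pivots) L : cell (val f) L ->
  limit0 R (fun t => gr_act (one_param t) L) (pivot_pt g) -> f = g.
Proof.
move=> [A AL Af] [psi [[_ _ psi_reg] psiE psi0]].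
apply: contrapT => fg.
pose rep (M : Gr k r n) := sval (cid (gr_matrix M)).
have repE (M : Gr k r n) : row_span (rep M) = val M by exact: svalP (cid (gr_matrix M)).
pose ratio (B : 'M[k]_(r, n)) := if \det (colsub (val g) B) == 0 then 1
  else \det (colsub (val f) B) / \det (colsub (val g) B).
have ratioE (M : Gr k r n) B : row_span B = val M -> ratio (rep M) = ratio B.
  move=> BM; have [h hU ->] :=
    row_span_eq (row_free_gr BM) (etrans BM (esym (repE M))).
  have h0 : \det h != 0 by rewrite -unitfE -unitmxE.
  rewrite /ratio -!mulmx_colsub !det_mulmx mulf_eq0 (negPf h0) /=.
  by case: ifP => // _; rewrite -mulf_div divff // mul1r.
have reg : regular_at R (ratio \o rep) (psi 0).
  exists (minor k (val f)), (minor k (val g)); split.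
    exists (mxvec (selector (val g))); first by rewrite psi0 /= mxvecK.
    by rewrite minorE mxvecK colsub_selector ?det1 ?oner_eq0 //; apply: pivot_inj.
  move=> M c _ cM; rewrite !minorE /= (ratioE _ _ cM) /ratio => /negPf ->.
  by [].
have [P [Q [[c cE Q0] PQ]]] := psi_reg _ _ Logic.I reg.
have [p pE] := meval_horner P (fun=> 'X); have [q qE] := meval_horner Q (fun=> 'X).
have lineE t : (fun=> 'X.[t]) = (const_mx t : 'rV[k]_1) 0 :> ('I_1 -> k).
  by apply/funext => i; rewrite mxE hornerX.
have {}pE t : p.[t] = P.@[(const_mx t : 'rV[k]_1) 0] by rewrite pE lineE.
have {}qE t : q.[t] = Q.@[(const_mx t : 'rV[k]_1) 0] by rewrite qE lineE.
have q0 : q.[0] != 0 by rewrite qE; move: Q0; rewrite cE.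
have qn0 : q != 0 by apply: contraNneq q0 => ->; rewrite horner0.
have {}PQ t : q.[t] != 0 -> ratio (rep (psi t)) = p.[t] / q.[t].
  by rewrite pE qE => qt; apply: (PQ t).
have minor0 : \det (colsub (val f) (selector (val g) : 'M[k]_(r, n))) = 0.
  apply/eqP; rewrite -[_ == 0]negbK -unitfE -unitmxE; apply/negP => U.
  by apply: fg; rewrite (pivot_minor U).
have p0 : p.[0] = 0.
  have := PQ 0 q0; rewrite psi0 (@ratioE _ (selector (val g))) // /ratio.
  rewrite minor0 mul0r colsub_selector ?det1 ?oner_eq0; last exact: pivot_inj.
  by move/esym/eqP; rewrite mulf_eq0 invr_eq0 (negPf q0) orbF => /eqP.
have [m mE] := meval_horner (minor k (val g)) (fun s => mxvec (flow_poly (val f) A) 0 s).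
have {}mE t : m.[t] = \det (colsub (val g) (flow (val f) A t)).
  rewrite mE -[flow _ _ _]mxvecK -minorE; congr (meval _ _); apply/funext => s.
  exact: flow_polyE.
have m0 : m.[0] = 0.
  rewrite mE flow0 //; apply/eqP; rewrite -[_ == 0]negbK -unitfE -unitmxE.
  by apply/negP => /pivot_minor.
have along t : t != 0 -> ratio (rep (psi t)) = if m.[t] == 0 then 1 else m.[t]^-1.
  move=> t0; rewrite (@ratioE _ (flow (val f) A t)); last first.
    by rewrite psiE // -(row_span_flow t0 AL Af).
  by rewrite /ratio -mE (proj1 (in_cell_flow t Af)) det1 div1r.
(* The minor m may vanish identically, in which case the extension by 1 makes
   the ratio constant along the flow. *)
suff /(congr1 (horner^~ 0)) : p * (if m == 0 then 1 else m) - q = 0.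
  by rewrite !hornerE p0 mul0r sub0r => /eqP; rewrite oppr_eq0 (negPf q0).
case: eqP => [m_0 | /eqP mn0].
  apply: (@poly_dense _ _ ('X * q)) => [|t]; first by rewrite mulf_neq0 ?polyX_eq0.
  rewrite hornerM hornerX mulf_eq0 negb_or => /andP[t0 qt].
  have := PQ t qt; rewrite along // m_0 horner0 eqxx => E.
  by rewrite mulr1 hornerD hornerN -[p.[t]](divfK qt) -E mul1r subrr.
apply: (@poly_dense _ _ ('X * q * m)) => [|t]; first by rewrite !mulf_neq0 ?polyX_eq0.
rewrite !hornerM hornerX !mulf_eq0 !negb_or -andbA => /and3P[t0 qt mt].
have := PQ t qt; rewrite along // (negPf mt) => E.
rewrite !hornerE (_ : p.[t] = m.[t]^-1 * q.[t]); last by rewrite E divfK.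
by rewrite mulrAC mulVf // mul1r subrr.
Qed.

Lemma BB_cellE (f : pivots) : BB_cell one_param R (pivot_pt f) = cell (val f).
Proof.
apply/seteqP; split=> L; last first.
  by move=> fL; split; [apply: pivots_cell fL | apply: cell_limit].
by move=> [RL lim]; have [g gL] := richardson_pivots RL; rewrite -(limit_cell gL lim).
Qed.

Lemma Gm_fixedE L : Gm_fixed one_param R L <-> exists f, pivot_pt f = L.
Proof.
split=> [[RL fix_L] | [f <-]].
  by have [f fL] := richardson_pivots RL; exists f; rewrite -(cell_fixed fL).
by split=> [|t]; [apply/pivots_cell/cell_pivot_pt | apply: pivot_pt_fixed].
Qed.

End Cells.

(** * The cells are affine spaces *)

Section CellAffine.
Variables (k : closedFieldType) (r n : nat) (a b f : 'I_r -> 'I_n).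
Hypotheses (fI : injective f) (fab : between a b f).
Implicit Types (A : 'M[k]_(r, n)) (L : Gr k r n).

Local Notation w := (weight b).

Definition free_entries : {set 'I_r * 'I_n} :=
  finset (fun e : 'I_r * 'I_n => [&& e.2 \notin codom f, (w e.2 <= w (f e.1))%N &
                                     between a b (upd f e.1 e.2)]).

Local Notation m := #|free_entries|.

Definition entry (s : 'I_m) : 'I_r * 'I_n := enum_val s.

Definition cell_mx (x : 'rV[k]_m) : 'M[k]_(r, n) :=
  \matrix_(i, j) ((j == f i)%:R + \sum_s x 0 s * ((i, j) == entry s)%:R).

Lemma cell_mx_entry x s : cell_mx x (entry s).1 (entry s).2 = x 0 s.
Proof.
have := enum_valP s; rewrite inE -/(entry s) => /andP[notf _].
rewrite mxE (_ : (_ == f _) = false) ?add0r; last first.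
  by apply: contraNF notf => /eqP ->; apply: codom_f.
rewrite (bigD1 s) //= -surjective_pairing eqxx mulr1 big1 ?addr0 // => s' ss'.
by rewrite (inj_eq enum_val_inj) eq_sym (negPf ss') mulr0.
Qed.

Lemma cell_mx_other x i j :
  (i, j) \notin free_entries -> cell_mx x i j = (j == f i)%:R.
Proof.
move=> ij; rewrite mxE big1 ?addr0 // => s _; case: eqP => [E|]; last by rewrite mulr0.
by move: ij; rewrite E (enum_valP s).
Qed.

Lemma in_cell_mx x : in_cell a b f (cell_mx x).
Proof.
split.
  apply/matrixP => i l; rewrite mxE cell_mx_other ?mxE ?(inj_eq fI) 1?eq_sym //.
  by rewrite inE /= codom_f.
move=> i j; have [| ij] := boolP ((i, j) \in free_entries).
  by rewrite inE /= => /and3P[_ -> ->].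
rewrite cell_mx_other //; have [-> _ | _] := eqVneq j (f i); last by rewrite eqxx.
rewrite leqnn (@eq_between _ _ _ _ _ f) // => l.
by rewrite /upd; case: eqP => [->|].
Qed.

Lemma in_cell_entries A : in_cell a b f A ->
  A = cell_mx (\row_s A (entry s).1 (entry s).2).
Proof.
case=> f1 Af; apply/matrixP => i j; have [ij | ij] := boolP ((i, j) \in free_entries).
  have [s sE] : exists s, entry s = (i, j).
    by exists (enum_rank_in ij (i, j)); rewrite /entry enum_rankK_in.
  have := cell_mx_entry (\row_s A (entry s).1 (entry s).2) s.
  by rewrite mxE sE.
rewrite cell_mx_other //; have [/codomP[l ->] | notf] := boolP (j \in codom f).
  by rewrite (colsub1E _ _ f1) (inj_eq fI) eq_sym.
have -> : (j == f i) = false by apply: contraNF notf => /eqP->; apply: codom_f.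
by apply/eqP; apply: contraNT ij => /Af; rewrite inE /= notf.
Qed.

(** The reduced matrix of the row span of A: it gives coordinates on the cell
    which are rational in the entries of any matrix of the point. *)
Definition reduce A : 'M[k]_(r, n) := invmx (colsub f A) *m A.

Lemma reduce_mul (h : 'M[k]_r) A : h \in unitmx -> colsub f A = 1%:M ->
  reduce (h *m A) = A.
Proof. by move=> hU f1; rewrite /reduce -mulmx_colsub f1 mulmx1 mulKmx. Qed.

Lemma reduce_cell L A B : row_span A = val L -> row_span B = val L ->
  in_cell a b f B -> colsub f A \in unitmx /\ reduce A = B.
Proof.
move=> AL BL [f1 _]; have [h hU ->] :=
  row_span_eq (row_free_gr BL) (etrans BL (esym AL)).
by rewrite reduce_mul // -mulmx_colsub f1 mulmx1.
Qed.

Definition cell_pt (x : affine_space k m) : Gr k r n :=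
  gr_pt (in_cell_free (in_cell_mx x)).

Definition cell_coord L : affine_space k m :=
  \row_s reduce (sval (cid (gr_matrix L))) (entry s).1 (entry s).2.

Lemma cell_coordE L A : row_span A = val L -> in_cell a b f A ->
  cell_coord L = \row_s A (entry s).1 (entry s).2.
Proof.
move=> AL Af; have [_ E] := reduce_cell (svalP (cid (gr_matrix L))) AL Af.
by apply/rowP => s; rewrite [LHS]mxE E [RHS]mxE.
Qed.

Lemma rational_reduce i j :
  rational (cell a b f) (fun c : 'rV[k]_(coord_dim (Gr k r n)) => reduce (vec_mx c) i j).
Proof.
pose G := generic_mx k r n.
apply: (@eq_rational _ (Gr k r n) _ _ (fun c => ((minor k f).@[c 0])^-1 *
    ((\adj (colsub f G) *m G) i j).@[c 0])).
  move=> L c [B BL Bf] cL; have [U _] := reduce_cell cL BL Bf.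
  rewrite /reduce /invmx U -scalemxAl mxE minorE; congr (_ * _).
  by rewrite -meval_generic_mx -map_mxsub -map_mx_adj -map_mxM mxE.
apply: rationalM; last exact: (rational_poly (M := Gr k r n) _ ((\adj (colsub f G) *m G) i j)).
apply: rationalV; last exact: (rational_poly (M := Gr k r n) _ (minor k f)).
move=> L c [B BL Bf] cL; have [U _] := reduce_cell cL BL Bf.
by rewrite minorE -unitfE -unitmxE.
Qed.

Lemma cell_affine : isomorphic (cell a b f) [set: affine_space k m].
Proof.
exists cell_coord, cell_pt; split.
- pose phi (c : 'rV[k]_(coord_dim (Gr k r n))) : 'rV[k]_m :=
    \row_s reduce (vec_mx c) (entry s).1 (entry s).2.
  have phiE L c : cell a b f L -> coords (Gr k r n) L c -> phi c = cell_coord L.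
    move=> [A AL Af] cL; rewrite (cell_coordE AL Af).
    by have [_ E] := reduce_cell cL AL Af; apply/rowP => s; rewrite [LHS]mxE E [RHS]mxE.
  apply: (@rational_morphism k (Gr k r n) _ (affine_space k m) _ cell_coord [set phi]).
  + by [].
  + by move=> L _; apply: gr_coords.
  + move=> _ -> s; apply: eq_rational (rational_reduce (entry s).1 (entry s).2).
    by move=> L c _ _; rewrite mxE.
  + by move=> _ L c -> fL cL; apply: phiE.
  + by move=> L c x fL cL ->; exists phi => //; rewrite (phiE L c).
- apply: (@morphism_to_gr _ _ _ (affine_space k m) _ _ _ cell_mx).
  + by move=> x _; exists (cell_mx x) => //; apply: in_cell_mx.
  + by move=> x _; exists x.
  + move=> i j; apply: (@eq_rational _ (affine_space k m) _ _
      (fun x => (j == f i)%:R + \sum_s x 0 s * ((i, j) == entry s)%:R)).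
      by move=> x c _ _; rewrite mxE.
    apply: rationalD; first exact: rational_const.
    apply: rational_sum => s; apply: rationalM; last exact: rational_const.
    exact: rational_coord.
  + by move=> x c _ ->.
- move=> L [A AL Af]; apply/val_inj => /=.
  by rewrite (cell_coordE AL Af) -in_cell_entries.
- move=> x _; rewrite (cell_coordE (A := cell_mx x) _ (in_cell_mx x)) //.
  by apply/rowP => s; rewrite mxE cell_mx_entry.
Qed.

End CellAffine.

(** * The paving *)

Section Paving.
Variables (k : closedFieldType) (r n : nat) (a b : 'I_r -> 'I_n).
Hypotheses (ai : increasing a) (bi : increasing b).
Hypothesis thin : forall x, (x <= n)%N -> (cnt a x <= (cnt b x).+1)%N.

Local Notation w := (weight b).
Local Notation R := (richardson_of (k := k) a b).

Definition pivot_weight (f : pivots a b) : nat := \sum_i w (val f i).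

(** Along a list of the fixed points by increasing weight, the first cells are
    cut out by the vanishing of the minors indexed by the later fixed points. *)
Lemma cells_paving (j : nat) (e : j.+1.-tuple (pivots a b)) :
  uniq e -> (forall f, f \in e) ->
  (forall i i' : 'I_j.+1, (i <= i')%N ->
     (pivot_weight (tnth e i) <= pivot_weight (tnth e i'))%N) ->
  affine_paving R (fun i => cell (k := k) a b (val (tnth e i))).
Proof.
move=> ue eall esort.
have later (i l : 'I_j.+1) (L : Gr k r n) A : (i < l)%N -> cell a b (val (tnth e i)) L ->
    row_span A = val L -> colsub (val (tnth e l)) A \notin unitmx.
  move=> il iL AL; apply/negP => U.
  have [_ /(_ (esort _ _ (ltnW il)))] := cell_dominant iL AL U.
  by move/(tuple_uniqP _ ue) => E; rewrite E ltnn in il.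
have own (i : 'I_j.+1) (L : Gr k r n) A : cell a b (val (tnth e i)) L ->
    row_span A = val L -> colsub (val (tnth e i)) A \in unitmx.
  by move=> [B BL Bf] AL; have [] := reduce_cell AL BL Bf.
have cover L : R L -> exists i, cell a b (val (tnth e i)) L.
  move=> /(richardson_pivots ai bi) [f fL].
  by have /tnthP[i fE] := eall f; exists i; rewrite -fE.
split.
- apply/seteqP; split=> [L /cover[i iL] | L [i _ iL]]; first by exists i.
  exact: (pivots_cell ai bi thin iL).
- move=> i i' ii'; apply/seteqP; split=> // L [iL i'L].
  have [A AL] := gr_matrix L.
  have := ii'; rewrite neq_ltn => /orP[] lt.
    by have := later _ _ _ _ lt iL AL; rewrite (own _ _ _ i'L AL).
  by have := later _ _ _ _ lt i'L AL; rewrite (own _ _ _ iL AL).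
- move=> i; pose S := [set P | exists2 l : 'I_j.+1, (i < l)%N & P = minor k (val (tnth e l))].
  exists [set L | forall P, S P -> forall c, coords (Gr k r n) L c -> P.@[c 0] = 0].
    by exists S.
  apply/seteqP; split=> [L [i' /= i'i i'L] | L [RL SL]].
    split; first exact: (pivots_cell ai bi thin i'L).
    move=> _ [l il ->] c cL; rewrite minorE; apply/eqP.
    rewrite -[_ == 0]negbK -unitfE -unitmxE.
    by apply: later i'L cL; apply: leq_ltn_trans il.
  have [l lL] := cover L RL; exists l => //=; rewrite leqNgt; apply/negP => il.
  have [c cL] := gr_coords L.
  have := own _ _ _ lL cL; rewrite unitmxE unitfE -minorE.
  by rewrite (SL _ _ _ cL) ?eqxx //; exists l.
- move=> i; exists #|free_entries a b (val (tnth e i))|.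
  by apply: cell_affine; [apply: pivot_inj | case/andP: (valP (tnth e i))].
Qed.

End Paving.

Theorem theorem1 (k : closedFieldType) (r n : nat) (le_rn : (r <= n)%N)
    (X : set (Gr k r n)) (toricX : toric_richardson X) :
  exists v : k -> 'M[k]_n,
    one_parameter_subgroup v /\
    finite_set (Gm_fixed v X) /\
    exists (j : nat) (p : 'I_j.+1 -> Gr k r n),
      injective p /\
      (forall x, Gm_fixed v X x <-> exists i, p i = x) /\
      affine_paving X (fun i => BB_cell v X (p i)) /\
      (forall i, torus_invariant (BB_cell v X (p i))).
Proof.
case: toricX => [[la [mu [laP muP mu_la XE]]] dense].
have [b [bi bE bla]] := partition_steps le_rn laP.
have [a [ai aE amu]] := partition_steps le_rn muP.
have ab i : (a i <= b i)%N.
  rewrite aE bE leq_add2r; move: mu_la; rewrite /included all2E => /andP[/eqP sz /allP H].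
  case/and3P: laP => /eqP sla _ _.
  have ir : (r - i.+1 < size mu)%N by rewrite sz sla; have := ltn_ord i; lia.
  apply: (H (nth 0%N mu (r - i.+1), nth 0%N la (r - i.+1))).
  by rewrite -nth_zip // mem_nth // size_zip -sz minnn.
have XR : X = richardson_of a b.
  rewrite XE /richardson /Omega_lower /Omega_upper.
  by rewrite (coord_subspaceE k bla) (coord_subspaceE k amu).
rewrite XR in dense *; move=> {X XE XR}.
have thin := dense_orbit_thin ai bi ab dense.
have bb : between a b b.
  apply/betweenP => x _; rewrite leqnn /=; apply: leq_sum => i _.
  by case: (ltnP (b i) x) => // bx; rewrite (leq_ltn_trans (ab i) bx).
pose e := sort (fun f g => pivot_weight f <= pivot_weight g)%N (enum (pivots a b : finType)).
have eall f : f \in e by rewrite mem_sort mem_enum.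
have ue : uniq e by rewrite sort_uniq enum_uniq.
have [j sz] : exists j, size e = j.+1.
  case E : e => [|f e']; last by exists (size e').
  have bE' : [ffun i => b i] =1 b by move=> i; rewrite ffunE.
  have ok : increasing [ffun i => b i] && between a b [ffun i => b i].
    rewrite (eq_between _ _ bE') bb andbT; apply/increasingP => i l il.
    by rewrite !bE' (increasingP _ bi).
  have := eall (exist (fun f : {ffun 'I_r -> 'I_n} => increasing f && between a b f) _ ok).
  by rewrite E.
pose t := Tuple (introT eqP sz : size e == j.+1).
have p_range x : Gm_fixed (one_param (k := k) b) (richardson_of a b) x <->
    exists i, pivot_pt k (tnth t i) = x.
  rewrite (Gm_fixedE ai bi thin); split=> [[f <-] | [i <-]]; last by eexists.
  by have /tnthP[i ->] : f \in t by []; exists i.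
have cellE i : BB_cell (one_param (k := k) b) (richardson_of a b) (pivot_pt k (tnth t i)) =
    cell a b (val (tnth t i)) by apply: BB_cellE.
exists (one_param (k := k) b); split; first exact: one_param_subgroup.
split.
  apply: (@sub_finite_set _ _ (range (fun i => pivot_pt k (tnth t i)))).
    by move=> x /p_range[i <-]; exists i.
  exact: finite_image.
exists j, (fun i => pivot_pt k (tnth t i)); split.
  have tI : injective (tnth t) by apply/tuple_uniqP.
  by move=> i i' /pivot_pt_inj/tI.
split; first exact: p_range.
split; last by move=> i; rewrite cellE; apply: cell_torus_invariant.
rewrite (_ : (fun i => _) = (fun i => cell a b (val (tnth t i)))); last first.
  by apply/funext => i; apply: cellE.
apply: cells_paving => // i i' ii'.
have f0 : pivots a b by exact: (tnth t ord0).
rewrite !(tnth_nth f0).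
apply: (sorted_leq_nth (leT := fun f g => pivot_weight f <= pivot_weight g)%N) => //.
- by move=> ? ? ?; apply: leq_trans.
- by apply: sort_sorted => ? ?; apply: leq_total.
- by rewrite inE sz.
- by rewrite inE sz.
Qed.
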